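(* Let $(A,p)$ be a Cartan super-datum and $\mathcal{R}=(\mathfrak h,\Pi,\Pi^\vee)$ a straight realization over $\Bbbk[[\hbar]]$, of rank $t$, of $P_A:=DA$. Fix a $\Bbbk[[\hbar]]$-basis $\{H_g\}_{g=1,\dots,t}$ of $\mathfrak h$, a matrix $\Phi=(\phi_{gk})\in\mathfrak{so}_t(\Bbbk[[\hbar]])$, the toral twist $\mathcal{F}_\Phi:=\exp\big(\hbar\,2^{-1}\sum_{g,k=1}^t\phi_{gk}H_g\otimes H_k\big)$, and let $\big(U^{\mathcal R,p}_{P_A,\hbar}(\mathfrak g)\big)^{\mathcal F_\Phi}$ be the corresponding deformed Hopf superalgebra. Then there exists an isomorphism of topological superalgebras $$f^\Phi:\ U^{\mathcal R_\Phi,p}_{(P_A)_\Phi,\hbar}(\mathfrak g)\ \xrightarrow{\ \cong\ }\ \big(U^{\mathcal R,p}_{P_A,\hbar}(\mathfrak g)\big)^{\mathcal F_\Phi}$$ given by $E_i\mapsto \mathcal L_{\Phi,i}^{-1}E_i$, $T\mapsto T$, $F_i\mapsto F_i\,\mathcal K_{\Phi,i}^{+1}$ for all $i\in I$, $T\in\mathfrak h$, where $$\mathcal L_{\Phi,i}:=e^{+\hbar 2^{-1}\sum_{g,k=1}^t\alpha_i(H_g)\phi_{gk}H_k},\qquad \mathcal K_{\Phi,i}:=e^{+\hbar 2^{-1}\sum_{g,k=1}^t\alpha_i(H_g)\phi_{kg}H_k}\ (=\mathcal L_{\Phi,i}^{-1}),$$ and $\mathcal R_\Phi$, $(P_A)_\Phi$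 are the twist deformations via $\Phi$ of $\mathcal R$ and $P_A$.
   Context: $\Bbbk$ is a field of characteristic zero, $I=\{1,\dots,n\}$; topological modules are over $\Bbbk[[\hbar]]$ and $\otimes$ is $\hbar$-adically completed. Cartan super-data. A Cartan super-datum $(A,p)$ is read off one of the following labelled Dynkin diagrams (vertices are white $\circ$, black $\bullet$ or grey $\otimes$; $\times$ means white or grey; vertices are numbered $1,\dots,n$ from left to right unless indicated): $A_n$: $\times-\times-\cdots-\times$; $B_n(I)$: $\times-\cdots-\times\Rightarrow\circ$; $B_n(II)$: $\times-\cdots-\times\Rightarrow\bullet$; $C_n$: $\times-\cdots-\times\Leftarrow\circ$; $D_n(I)$: a chain of $\times$-vertices $1,\dots,n-2$ with $n-2$ joined to two white vertices $n-1$, $n$; $D_n(II)$: the same with $n-1,n$ grey and joined to each other by a double edge; $F_4$: $\circ_1-\circ_4\Rightarrow\circ_3-\otimes_2$; $G_3$: $\otimes_1-\circ_3\Leftarrow\circ_2$ (triple edge, arrow towards vertex $3$). The parity $p:I\to\mathbb{Z}_2=\{\bar0,\bar1\}$ is $\bar0$ on white and $\bar1$ on black or grey vertices; $A=(a_{ij})\in M_n(\mathbb{Z})$ is the (symmetrizable) Cartan matrix attached to the diagram as follows. In types $A_n,B_n,C_n,D_n$ let $e_1,e_2,\dots$ be orthogonal vectors with $(e_i,e_i)=\varepsilon_i\in\{1,-1\}$, and put $\beta_i=e_i-e_{i+1}$ for $i\le n-1$ and $\beta_n=e_n-e_{n+1}$, $e_n$, $2e_n$, $e_{n-1}+e_n$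 in type $A_n$, $B_n$, $C_n$, $D_n$ respectively, where $\varepsilon_{i+1}=\varepsilon_i$ if vertex $i$ is white and $\varepsilon_{i+1}=-\varepsilon_i$ if it is grey, for all $i$ with $\beta_i=e_i-e_{i+1}$; then $a_{ij}=2(\beta_i,\beta_j)/(\beta_i,\beta_i)$ if vertex $i$ is white or black, and $a_{ij}=\varepsilon_i(\beta_i,\beta_j)$ if it is grey (with $\varepsilon_{n-1}$ in place of $\varepsilon_i$ for $i=n$ in type $D_n(II)$). In type $F_4$ the nonzero entries are $a_{11}=a_{33}=a_{44}=2$, $a_{14}=a_{41}=a_{43}=a_{32}=-1$, $a_{34}=-2$, $a_{23}=1$; in type $G_3$ they are $a_{22}=a_{33}=2$, $a_{13}=1$, $a_{31}=a_{23}=-1$, $a_{32}=-3$. Fix minimal $d_i\in\frac12\mathbb{Z}\setminus\{0\}$ such that $DA$ is symmetric with integral entries, $D=\mathrm{diag}(d_i)$ (in types $A$–$D$, with overall sign such that $DA$ is a positive multiple of $((\beta_i,\beta_j))_{i,j}$). Realizations. $P=(p_{ij})\in M_n(\Bbbk[[\hbar]])$ is of Cartan type, with associated Cartan matrix $A$, if $\frac12(P+P^T)=DA$. A realization of $P$ is $\mathcal R=(\mathfrak h,\Pi,\Pi^\vee)$ with $\mathfrak h$ a free $\Bbbk[[\hbar]]$-module of finite rank (the rank of $\mathcal R$), $\Pi^\vee=\{T_i^+,T_i^-\}_{i\in I}\subseteq\mathfrak h$, $\Pi=\{\alpha_i\}_{i\in I}\subseteq\mathfrak h^*$, such that $\alpha_j(T_i^+)=p_{ij}$,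 $\alpha_j(T_i^-)=p_{ji}$, and the classes of $S_i:=\frac12(T_i^++T_i^-)$ are $\Bbbk$-linearly independent in $\mathfrak h/\hbar\mathfrak h$. It is straight if the classes of the $\alpha_i$ are linearly independent in $\mathfrak h^*/\hbar\mathfrak h^*$. The FoMpQUESA $U^{\mathcal R,p}_{P,\hbar}(\mathfrak g)$. Put $q=e^\hbar$, $q_i=e^{\hbar d_i}$, $k_{ij}=e^{\hbar(p_{ij}-p_{ji})/2}$, $\nu_i=q^{\varepsilon_i}$, where $(\varepsilon_i)=(6,-2,-2,-2)$ for $F_4$, $(-2,2,6)$ for $G_3$, and otherwise $\varepsilon_i=\pm1$ are the square lengths $(e_i,e_i)$ of the orthogonal vectors in terms of which the simple roots are expressed in the usual way ($\alpha_i=e_i-e_{i+1}$, etc.), with $\varepsilon_n=\varepsilon_{n-1}$ for $D_n(I)$ and $\varepsilon_n=-\varepsilon_{n-1}$ for $D_n(II)$. For products $X,Y$ of $E$'s with multiplicities $(b_i)$, $(c_j)$ of the $E_i$'s, set $\langle X,Y\rangle_\nu:=XY-(-1)^{|X||Y|}\nu\big(\prod_{i,j}k_{ij}^{b_ic_j}\big)YX$ (extended linearly to homogeneous combinations), $\langle X,Y\rangle:=\langle X,Y\rangle_1$; for products of $F$'s use the same with $k_{ji}$ in place of $k_{ij}$. $U^{\mathcal R,p}_{P,\hbar}(\mathfrak g)$ is the unital associative topological $\hbar$-adically complete $\Bbbk[[\hbar]]$-superalgebra topologically generated by the module $\mathfrak h$ (even) and $E_i,F_i$ ($i\in I$) of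 parity $p(i)$, with relations: $TT'=T'T$; $TE_j-E_jT=\alpha_j(T)E_j$; $TF_j-F_jT=-\alpha_j(T)F_j$; $E_iF_j-(-1)^{p(i)p(j)}F_jE_i=\delta_{ij}\frac{e^{\hbar T_i^+}-e^{-\hbar T_i^-}}{q_i-q_i^{-1}}$; for $i\ne j$, $p(i)=\bar0$: $\sum_{s=0}^{1-a_{ij}}(-1)^s\binom{1-a_{ij}}{s}_{[q_i]}k_{ij}^sE_i^{1-a_{ij}-s}E_jE_i^s=0$ and the same with $F$ for $E$ and $k_{ji}$ for $k_{ij}$ (symmetric Gaussian binomials in $q_i$); and for $X\in\{E,F\}$: $\langle X_i,X_j\rangle=0$ if $a_{ij}=0$; and (2) $\langle\langle\langle X_i,X_j\rangle_{\nu_j},X_k\rangle_{\nu_{j+1}},X_j\rangle=0$ whenever $i,j,k$ form a subdiagram $\times_i-\otimes_j-\times_k$, $\times_i-\otimes_j\Rightarrow\bullet_k$ or $\times_i-\otimes_j\Rightarrow\times_k$; (3) $\langle\langle\langle X_{n-1},X_n\rangle_{\nu_n},X_n\rangle,X_n\rangle_{\nu_n^{-1}}=0$ in type $B_n$ with $\times_{n-1}\Rightarrow\bullet_n$; (4) $\langle\langle X_{n-2},X_{n-1}\rangle_{\nu_{n-1}},X_n\rangle_{\nu_n}=\langle\langle X_{n-2},X_n\rangle_{\nu_{n-1}},X_{n-1}\rangle_{\nu_n}$ in type $D_n(II)$; (5) $\langle\langle\langle\langle X_{n-2},X_{n-1}\rangle_{\nu_{n-1}},X_n\rangle_{\nu_n},\langle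 X_{n-2},X_{n-1}\rangle_{\nu_{n-1}}\rangle,X_{n-1}\rangle_{\nu_{n-1}}=0$ in type $C_n$ with $\otimes_{n-2}-\otimes_{n-1}\Leftarrow\circ_n$; (6) $\langle\langle\langle\langle\langle\langle X_{n-3},X_{n-2}\rangle_{\nu_{n-2}},X_{n-1}\rangle_{\nu_{n-1}},X_n\rangle_{\nu_n},X_{n-1}\rangle_{\nu_n},X_{n-2}\rangle_{\nu_{n-1}},X_{n-1}\rangle=0$ in type $C_n$ with $\times_{n-3}-\otimes_{n-2}-\otimes_{n-1}\Leftarrow\circ_n$. For $P=P_A$ and $\mathcal R$ straight (Yamane's QUESA) this superalgebra is known (Yamane) to be a topological Hopf superalgebra with $\Delta(E_i)=E_i\otimes1+e^{\hbar T_i^+}\otimes E_i$, $\Delta(T)=T\otimes1+1\otimes T$, $\Delta(F_i)=F_i\otimes e^{-\hbar T_i^-}+1\otimes F_i$, $\epsilon(E_i)=\epsilon(T)=\epsilon(F_i)=0$, $S(E_i)=-e^{-\hbar T_i^+}E_i$, $S(T)=-T$, $S(F_i)=-F_ie^{\hbar T_i^-}$. Twist deformations. For a twist $\mathcal F$, $U^{\mathcal F}$ is $U$ with the same superalgebra structure and counit, coproduct $\mathcal F\Delta(\cdot)\mathcal F^{-1}$ and antipode $vS(\cdot)v^{-1}$, $v=\sum S(f_1')f_2'$, $\mathcal F^{-1}=\sum f'_1\otimes f'_2$. For $P$ with realization $\mathcal R$ and $\mathfrak A:=(\alpha_i(H_g))$: $P_\Phi:=P-\mathfrak A\Phi\mathfrak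 A^T$, $T^\pm_{\Phi,i}:=T^\pm_i\pm\sum_{g,k}\alpha_i(H_g)\phi_{kg}H_k$, $\mathcal R_\Phi:=(\mathfrak h,\Pi,\{T^\pm_{\Phi,i}\})$, a realization of $P_\Phi$.
   Formalization: Relation (4) (type D_n(II)) carries an extra factor k_{n-1,n} (k_{n,n-1} for F) on its right-hand side; as printed, without it, the map f^Φ does not respect (4) when k_{n-1,n}≠1. The two forms agree when k_{n-1,n}=1, in particular for P_A. *)

(* Defs.v *)
From HB Require Import structures.
From mathcomp Require Import all_boot all_order all_algebra.
From mathcomp Require Import boolp.
From mathcomp Require Import finmap monalg.

Set Implicit Arguments.
Unset Strict Implicit.
Unset Printing Implicit Defensive.

Import Order.TTheory GRing.Theory Num.Theory.

Local Open Scope ring_scope.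
Local Open Scope quotient_scope.

(** * Formal power series in hbar *)

(* [hser A] is A[[hbar]], for a possibly noncommutative ring A in which hbar
   is central. *)
Record hser (A : Type) := Hser { hcoef : nat -> A }.
Arguments hcoef {A} _ _.

HB.instance Definition _ (A : Type) := gen_eqMixin (hser A).
HB.instance Definition _ (A : Type) := gen_choiceMixin (hser A).

Lemma hserP (A : Type) (x y : hser A) : (forall m, hcoef x m = hcoef y m) -> x = y.
Proof. by case: x y => [x] [y] /= e; congr Hser; apply/funext. Qed.

Section HserZmod.
Variable V : zmodType.

Definition hser_zero : hser V := Hser (fun=> 0).
Definition hser_opp (x : hser V) : hser V := Hser (fun m => - hcoef x m).
Definition hser_add (x y : hser V) : hser V :=
  Hser (fun m => hcoef x m + hcoef y m).

Fact hser_addA : associative hser_add.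
Proof. by move=> x y z; apply: hserP => m /=; rewrite addrA. Qed.
Fact hser_addC : commutative hser_add.
Proof. by move=> x y; apply: hserP => m /=; rewrite addrC. Qed.
Fact hser_add0 : left_id hser_zero hser_add.
Proof. by move=> x; apply: hserP => m /=; rewrite add0r. Qed.
Fact hser_addN : left_inverse hser_zero hser_opp hser_add.
Proof. by move=> x; apply: hserP => m /=; rewrite addNr. Qed.

HB.instance Definition _ :=
  GRing.isZmodule.Build (hser V) hser_addA hser_addC hser_add0 hser_addN.

Lemma hcoef0 m : hcoef (0 : hser V) m = 0. Proof. by []. Qed.
Lemma hcoefN (x : hser V) m : hcoef (- x) m = - hcoef x m. Proof. by []. Qed.
Lemma hcoefD (x y : hser V) m : hcoef (x + y) m = hcoef x m + hcoef y m.
Proof. by []. Qed.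
Lemma hcoefB (x y : hser V) m : hcoef (x - y) m = hcoef x m - hcoef y m.
Proof. by []. Qed.
End HserZmod.

Section HserRing.
Variable A : nzRingType.
Implicit Types x y z : hser A.

Definition hcst (a : A) : hser A := Hser (fun m => if m is 0 then a else 0).

Definition hser_mul x y : hser A :=
  Hser (fun m => \sum_(i < m.+1) hcoef x i * hcoef y (m - i)%N).

Arguments hser_mul : simpl never.

Fact hcoef_mul x y m :
  hcoef (hser_mul x y) m = \sum_(i < m.+1) hcoef x i * hcoef y (m - i)%N.
Proof. by []. Qed.

Fact hcoef_mul_rev x y m :
  hcoef (hser_mul x y) m = \sum_(i < m.+1) hcoef x (m - i)%N * hcoef y i.
Proof.
rewrite /= (reindex_inj rev_ord_inj) /=.
by apply: eq_bigr => j _; rewrite (sub_ordK j).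
Qed.

Fact hser_mulA : associative hser_mul.
Proof.
move=> p q r; apply: hserP => i.
rewrite hcoef_mul hcoef_mul_rev.
pose coef3 j k := hcoef p j * (hcoef q (i - j - k)%N * hcoef r k).
transitivity (\sum_(j < i.+1) \sum_(k < i.+1 | (k <= i - j)%N) coef3 j k).
  apply: eq_bigr => j _; rewrite hcoef_mul_rev big_distrr /=.
  by rewrite (big_ord_narrow_leq (leq_subr _ _)).
rewrite (exchange_big_dep predT) //; apply: eq_bigr => k _.
transitivity (\sum_(j < i.+1 | (j <= i - k)%N) coef3 j k).
  apply: eq_bigl => j; rewrite -ltnS -(ltnS j) -!subSn ?leq_ord //.
  by rewrite -subn_gt0 -(subn_gt0 j) -!subnDA addnC.
rewrite (big_ord_narrow_leq (leq_subr _ _)) hcoef_mul big_distrl /=.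
by apply: eq_bigr => j _; rewrite /coef3 -!subnDA addnC mulrA.
Qed.

Fact hser_mul1 : left_id (hcst 1) hser_mul.
Proof.
move=> x; apply: hserP => m; rewrite hcoef_mul big_ord_recl subn0 /= mul1r.
by rewrite big1 ?addr0 // => j _; rewrite mul0r.
Qed.

Fact hser_mulr1 : right_id (hcst 1) hser_mul.
Proof.
move=> x; apply: hserP => m; rewrite hcoef_mul_rev big_ord_recl subn0 /= mulr1.
by rewrite big1 ?addr0 // => j _; rewrite mulr0.
Qed.

Fact hser_mulDl : left_distributive hser_mul +%R.
Proof.
move=> x y z; apply: hserP => m; rewrite hcoefD !hcoef_mul -big_split /=.
by apply: eq_bigr => j _; rewrite mulrDl.
Qed.

Fact hser_mulDr : right_distributive hser_mul +%R.
Proof.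
move=> x y z; apply: hserP => m; rewrite hcoefD !hcoef_mul -big_split /=.
by apply: eq_bigr => j _; rewrite mulrDr.
Qed.

Fact hser_1neq0 : hcst 1 != 0.
Proof.
apply/eqP => /(congr1 (fun x => hcoef x 0%N)) /= /eqP.
by rewrite oner_eq0.
Qed.

HB.instance Definition _ := GRing.Zmodule_isNzRing.Build (hser A)
  hser_mulA hser_mul1 hser_mulr1 hser_mulDl hser_mulDr hser_1neq0.

Lemma hcoefM x y m :
  hcoef (x * y) m = \sum_(i < m.+1) hcoef x i * hcoef y (m - i)%N.
Proof. by []. Qed.

Lemma hcoefMr x y m :
  hcoef (x * y) m = \sum_(i < m.+1) hcoef x (m - i)%N * hcoef y i.
Proof. exact: hcoef_mul_rev. Qed.

Definition hbar : hser A := Hser (fun m => if m is 1 then 1 else 0).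

Lemma hcoef_hbarXM N x m :
  hcoef (hbar ^+ N * x) m = if (m < N)%N then 0 else hcoef x (m - N)%N.
Proof.
elim: N m => [|N IH] m; first by rewrite mul1r subn0.
rewrite exprS -mulrA hcoefM; case: m => [|m].
  by rewrite big_ord1 mul0r.
rewrite !big_ord_recl big1 => [|i _]; last exact: mul0r.
rewrite addr0 [X in X + _]mul0r add0r [LHS]mul1r IH ltnS subSS.
by rewrite lift0 subSS subn0.
Qed.

(* The hbar-adically convergent sum of hbar^N u_N. *)
Definition hsum (u : nat -> hser A) : hser A :=
  Hser (fun m => \sum_(N < m.+1) hcoef (u N) (m - N)%N).

Lemma hsumE u N :
  exists y, hsum u - \sum_(i < N) hbar ^+ i * u i = hbar ^+ N * y.
Proof.
have sE m : hcoef (\sum_(i < N) hbar ^+ i * u i) m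
    = \sum_(i < N) hcoef (hbar ^+ i * u i) m.
  by elim/big_rec2: _ => // i a b _ <-.
exists (Hser (fun m => hcoef (hsum u - \sum_(i < N) hbar ^+ i * u i) (m + N)%N)).
apply: hserP => m; rewrite hcoef_hbarXM; case: ltnP => [ltmN|leNm]; last first.
  by rewrite /= subnK.
rewrite hcoefB sE; apply/eqP; rewrite subr_eq0; apply/eqP.
under [RHS]eq_bigr do rewrite hcoef_hbarXM.
rewrite [LHS](big_ord_widen N (fun i => hcoef (u i) (m - i)%N)) // big_mkcond.
by apply: eq_bigr => i _; rewrite ltnS; case: leqP.
Qed.
End HserRing.
Arguments hbar {A}.

Section HserCom.
Variable A : comNzRingType.
Fact hser_mulC : @commutative (hser A) _ *%R.
Proof.
move=> x y; apply: hserP => m; rewrite hcoefM hcoefMr.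
by apply: eq_bigr => i _; rewrite mulrC.
Qed.
HB.instance Definition _ := GRing.PzRing_hasCommutativeMul.Build (hser A) hser_mulC.
End HserCom.

Section HserMap.
Variables (A B : nzRingType) (f : {rmorphism A -> B}).
Definition hmap (x : hser A) : hser B := Hser (fun m => f (hcoef x m)).

Lemma hmapD : {morph hmap : x y / x + y}.
Proof. by move=> x y; apply: hserP => m /=; rewrite rmorphD. Qed.
Lemma hmapM : {morph hmap : x y / x * y}.
Proof.
move=> x y; apply: hserP => m; rewrite hcoefM.
transitivity (f (hcoef (x * y) m)); first by [].
by rewrite hcoefM rmorph_sum; apply: eq_bigr => i _; rewrite rmorphM.
Qed.
Lemma hmap1 : hmap 1 = 1.
Proof. by apply: hserP => -[|m] /=; rewrite ?rmorph1 ?rmorph0. Qed.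
Lemma hmap_hbar : hmap hbar = hbar.
Proof. by apply: hserP => -[|[|m]] /=; rewrite ?rmorph1 ?rmorph0. Qed.
Lemma hmapX x n : hmap (x ^+ n) = hmap x ^+ n.
Proof. by elim: n => [|n IH]; rewrite ?hmap1 // !exprS hmapM IH. Qed.
End HserMap.

(** * Topological superalgebras over K[[hbar]] *)

(* Unital associative algebras.  Unlike [algType] this includes the zero
   algebra, which an algebra given by generators and relations may be. *)
Record uAlg (R : comNzRingType) := UAlg {
  uaRing : pzRingType;
  uaScale : R -> uaRing -> uaRing;
  uaScaleA : forall a b x, uaScale a (uaScale b x) = uaScale (a * b) x;
  uaScale1 : left_id 1 uaScale;
  uaScaleDr : right_distributive uaScale +%R;
  uaScaleDl : forall x, {morph uaScale^~ x : a b / a + b};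
  uaScaleAl : forall a x y, uaScale a (x * y) = uaScale a x * y;
  uaScaleAr : forall a x y, uaScale a (x * y) = x * uaScale a y
}.

Definition uaSort (R : comNzRingType) (A : uAlg R) : Type := uaRing A.
Coercion uaSort : uAlg >-> Sortclass.

HB.instance Definition _ (R : comNzRingType) (A : uAlg R) :=
  GRing.PzRing.copy (uaSort A) (uaRing A).
HB.instance Definition _ (R : comNzRingType) (A : uAlg R) :=
  GRing.Zmodule_isLmodule.Build R (uaSort A)
    (@uaScaleA R A) (@uaScale1 R A) (@uaScaleDr R A) (@uaScaleDl R A).

Section Hadic.
Variables (K : fieldType) (V : lmodType (hser K)).

(* x lies in hbar^N V; these submodules are a basis of neighbourhoods of 0. *)
Definition hdiv (N : nat) (x : V) : Prop := exists y, x = hbar ^+ N *: y.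

Definition hcomplete : Prop :=
  (forall x : V, (forall N, hdiv N x) -> x = 0) /\
  (forall u : nat -> V, (forall N, hdiv N (u N.+1 - u N)) ->
     exists l, forall N, hdiv N (l - u N)).
End Hadic.

(* The Z/2-grading is given by the projections [spart false], [spart true] onto
   the even and the odd part; x is homogeneous of parity s when
   [spart s x = x]. *)
Record topSuperAlg (K : fieldType) := TopSuperAlg {
  tsAlg :> uAlg (hser K);
  spart : bool -> tsAlg -> tsAlg;
  spart_linear : forall s, linear (spart s);
  spart_spart : forall s t x,
    spart s (spart t x) = if s == t then spart t x else 0;
  spart_sum : forall x, spart false x + spart true x = x;
  spart_one : spart false 1 = 1;
  spart_mul : forall s t x y,
    spart (s (+) t) (spart s x * spart t y) = spart s x * spart t y;
  tsComplete : hcomplete tsAlg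
}.
Arguments spart {K t} _ _ : rename.

Section BaseRing.
Variable K : fieldType.
Local Notation R := (hser K).

Lemma hser_complete (A : nzRingType) (V : lmodType R)
    (g : hser A -> V) (g' : V -> hser A) :
  cancel g g' -> cancel g' g -> {morph g : x y / x - y} ->
  (forall N x, g (hbar ^+ N * x) = hbar ^+ N *: g x) -> hcomplete V.
Proof.
move=> gK g'K gB gh; split=> [x xN|u uN].
  rewrite -[x]g'K; have -> : g' x = 0; last by rewrite -(subrr 0) gB subrr.
  apply: hserP => m; have [y xE] := xN m.+1.
  by rewrite xE -[y]g'K -gh gK hcoef_hbarXM ltnSn.
have /choice[y yE] : forall N, exists y, u N.+1 - u N = hbar ^+ N *: g y.
  by move=> N; have [y ->] := uN N; exists (g' y); rewrite g'K.
exists (g (hsum y) + u 0%N) => N; have [z zE] := hsumE y N.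
exists (g z); rewrite -gh -zE gB.
have g0 : g 0 = 0 by rewrite -(subrr 0) gB subrr.
have gN x : g (- x) = - g x by rewrite -sub0r gB g0 sub0r.
have gD a b : g (a + b) = g a + g b by rewrite -[b]opprK gB !gN.
rewrite -addrA; congr (_ + _).
elim: N {z zE} => [|N IH]; first by rewrite big_ord0 g0 subrr oppr0.
rewrite big_ord_recr /= gD gh -yE opprD -IH.
by rewrite opprB -addrA [u N - _]addrC addrA [_ + u N]addrC addrA addrNK.
Qed.

(* K[[hbar]] itself, purely even. *)
Definition baseAlg : uAlg R :=
  @UAlg R R *%R (@mulrA R) (@mul1r R) (@mulrDr R) (fun x a b => mulrDl a b x)
    (@mulrA R) (@mulrCA R).

Definition base_part (s : bool) (x : baseAlg) : baseAlg := if s then 0 else x.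

Fact base_linear s : linear (base_part s).
Proof. by case: s => // r x y /=; rewrite scaler0 addr0. Qed.
Fact base_part_part s t x :
  base_part s (base_part t x) = if s == t then base_part t x else 0.
Proof. by case: s t => -[]. Qed.
Fact base_sum x : base_part false x + base_part true x = x.
Proof. exact: addr0. Qed.
Fact base_mul s t x y :
  base_part (s (+) t) (base_part s x * base_part t y)
  = base_part s x * base_part t y.
Proof. by case: s t => -[] //=; rewrite ?mulr0 ?mul0r. Qed.
Fact base_complete : hcomplete baseAlg.
Proof. exact: (@hser_complete K baseAlg id id). Qed.

Definition baseTSA : topSuperAlg K :=
  TopSuperAlg base_linear base_part_part base_sum (erefl _) base_mul
    base_complete.
End BaseRing.

(* Some x satisfying P, or x0 when there is none. *)
Definition choose_with (T : Type) (x0 : T) (P : T -> Prop) : T :=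
  if pselect (exists x, P x) is left e then projT1 (cid e) else x0.

(* The inverse of a unit (0 elsewhere). *)
Definition rinv (A : pzRingType) (x : A) : A :=
  choose_with 0 (fun y => x * y = 1 /\ y * x = 1).

Section Exponential.
Variables (K : fieldType) (A : topSuperAlg K).

(* y is the hbar-adic limit of the partial sums of exp (hbar x). *)
Definition is_hexp (x y : A) : Prop :=
  forall N, hdiv N (y - \sum_(i < N) (hcst (i`!%:R)^-1 * hbar ^+ i) *: x ^+ i).

(* exp (hbar x); in characteristic zero the limit exists and is unique, since A
   is complete. *)
Definition hexp (x : A) : A := choose_with 0 (is_hexp x).
End Exponential.

Section Morphisms.
Variable K : fieldType.

Definition is_salg_morph (A B : topSuperAlg K) (f : A -> B) : Prop :=
  [/\ linear f, f 1 = 1, {morph f : x y / x * y} &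
      forall s x, f (spart s x) = spart s (f x)].

Definition is_tsalg_iso (A B : topSuperAlg K) (f : A -> B) : Prop :=
  [/\ is_salg_morph f, bijective f & forall N x, hdiv N (f x) <-> hdiv N x].
End Morphisms.

(** * Complete superalgebras given by generators and relations *)

(* M[[hbar]], for a superalgebra M over K. *)
Section SeriesSuperAlg.
Variables (K : fieldType) (M : lalgType K) (part : bool -> M -> M).
Hypothesis M_central : forall (c : K) (g : M), c%:A * g = g * c%:A.
Hypothesis part_linear : forall s, linear (part s).
Hypothesis part_part : forall s t g,
  part s (part t g) = if s == t then part t g else 0.
Hypothesis part_sum : forall g, part false g + part true g = g.
Hypothesis part_one : part false 1 = 1.
Hypothesis part_mul : forall s t g h,
  part (s (+) t) (part s g * part t h) = part s g * part t h.
Local Notation R := (hser K).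

Definition series_scale (r : R) (x : hser M) : hser M :=
  hmap (GRing.in_alg M) r * x.

Fact series_scaleA a b x :
  series_scale a (series_scale b x) = series_scale (a * b) x.
Proof. by rewrite /series_scale hmapM mulrA. Qed.
Fact series_scale1 : left_id 1 series_scale.
Proof. by move=> x; rewrite /series_scale hmap1 mul1r. Qed.
Fact series_scaleDr : right_distributive series_scale +%R.
Proof. by move=> a x y; rewrite /series_scale mulrDr. Qed.
Fact series_scaleDl x : {morph series_scale^~ x : a b / a + b}.
Proof. by move=> a b; rewrite /series_scale hmapD mulrDl. Qed.
Fact series_scaleAl a x y : series_scale a (x * y) = series_scale a x * y.
Proof. exact: mulrA. Qed.
Fact series_scaleAr a x y : series_scale a (x * y) = x * series_scale a y.
Proof.
rewrite /series_scale !mulrA; congr (_ * y); apply: hserP => m.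
by rewrite hcoefM hcoefMr; apply: eq_bigr => i _; apply: M_central.
Qed.

Definition seriesAlg : uAlg R :=
  UAlg series_scaleA series_scale1 series_scaleDr series_scaleDl
    series_scaleAl series_scaleAr.

Definition series_part (s : bool) (x : seriesAlg) : seriesAlg :=
  Hser (fun m => part s (hcoef x m)).

Fact part0 s : part s 0 = 0.
Proof. by have := part_linear s (-1) 0 0; rewrite !scaleN1r oppr0 addr0 addNr. Qed.
Fact partD s : {morph part s : g h / g + h}.
Proof. by move=> g h; have := part_linear s 1 g h; rewrite !scale1r. Qed.
Fact partZ s c g : part s (c *: g) = c *: part s g.
Proof. by have := part_linear s c g 0; rewrite part0 !addr0. Qed.
Fact part_bigsum s m (F : 'I_m -> M) :
  part s (\sum_i F i) = \sum_i part s (F i).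
Proof. exact: (big_morph _ (partD s) (part0 s)). Qed.

Fact series_linear s : linear (series_part s).
Proof.
move=> r x y; apply: hserP => m.
transitivity (part s (hcoef (hmap (GRing.in_alg M) r * x) m + hcoef y m)) => //.
rewrite partD; congr (_ + _); rewrite hcoefM part_bigsum.
transitivity (hcoef (hmap (GRing.in_alg M) r * series_part s x) m) => //.
by rewrite hcoefM; apply: eq_bigr => i _; rewrite /= !mulr_algl partZ.
Qed.
Fact series_part_part s t x :
  series_part s (series_part t x) = if s == t then series_part t x else 0.
Proof. by apply: hserP => m /=; rewrite part_part; case: ifP. Qed.
Fact series_sum x : series_part false x + series_part true x = x.
Proof. by apply: hserP => m /=; rewrite part_sum. Qed.
Fact series_one : series_part false 1 = 1.
Proof. by apply: hserP => -[|m] /=; rewrite ?part_one ?part0. Qed.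
Fact series_mul s t x y :
  series_part (s (+) t) (series_part s x * series_part t y)
  = series_part s x * series_part t y.
Proof.
apply: hserP => m.
pose xy : hser M := (series_part s x : hser M) * (series_part t y : hser M).
transitivity (part (s (+) t) (hcoef xy m)) => //.
transitivity (hcoef xy m) => //.
by rewrite /xy hcoefM part_bigsum; apply: eq_bigr => i _; apply: part_mul.
Qed.
Fact series_complete : hcomplete seriesAlg.
Proof.
apply: (@hser_complete K M seriesAlg id id) => // N x.
transitivity (hmap (GRing.in_alg M) (hbar ^+ N) * (x : hser M)) => //.
by rewrite hmapX hmap_hbar.
Qed.

Definition seriesTSA : topSuperAlg K :=
  TopSuperAlg series_linear series_part_part series_sum series_one series_mul
    series_complete.
End SeriesSuperAlg.

Section FreeSuperAlg.
Variables (K : fieldType) (X : choiceType) (p : X -> bool).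
Local Notation M := {malg K[{fmonom X}]}.

Definition wpar (w : {fmonom X}) : bool := odd (count p w).

Definition mpart (s : bool) (g : M) : M :=
  \sum_(w <- msupp g | wpar w == s) << g@_w *g w >>.

Fact mcoeff_mpart s g w : (mpart s g)@_w = if wpar w == s then g@_w else 0.
Proof.
rewrite raddf_sum /= big_mkcond /=.
have [wg|wg] := boolP (w \in msupp g).
  rewrite (bigD1_seq w) ?fset_uniq //= mcoeffUU big1 ?addr0 // => v /negPf vw.
  by case: ifP => // _; rewrite mcoeffU vw mulr0n.
rewrite big_seq big1 => [|v vg].
  by case: ifP => // _; rewrite mcoeff_outdom.
case: ifP => // _; rewrite mcoeffU.
by case: eqP => // vw; rewrite -vw vg in wg.
Qed.

Fact malg_central (c : K) (g : M) : c%:A * g = g * c%:A.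
Proof.
have cE : c%:A = << c *g (mone : {fmonom X}) >> :> M.
  by rewrite -mul_malgC mulr1.
rewrite {1}cE mul_malgC {1}[g]monalgE cE [RHS]fgmulgU scaler_sumr.
apply: eq_bigr => w _; rewrite mulm1 mulrC.
by apply/malgP => v; rewrite mcoeffZ !mcoeffU mulrnAr.
Qed.

Opaque mpart.

Fact mpart_linear s : linear (mpart s).
Proof.
move=> c g h; apply/malgP => w.
rewrite [RHS]mcoeffD (mcoeffZ c (mpart s g)) !(mcoeff_mpart s _ w).
by case: ifP => _; [rewrite mcoeffD mcoeffZ | rewrite mulr0 addr0].
Qed.
Fact mpart_part s t g : mpart s (mpart t g) = if s == t then mpart t g else 0.
Proof.
apply/malgP => w; rewrite 2!mcoeff_mpart; case: (s =P t) => [->|st].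
  by rewrite mcoeff_mpart; case: (_ == t).
rewrite mcoeff0; case: ifP => // /eqP ws; case: ifP => // /eqP wt.
by case: st; rewrite -ws -wt.
Qed.
Fact mpart_sum g : mpart false g + mpart true g = g.
Proof.
apply/malgP => w; rewrite mcoeffD 2!mcoeff_mpart.
by case: (wpar w); rewrite ?add0r ?addr0.
Qed.
Fact mpart_one : mpart false 1 = 1.
Proof.
apply/malgP => w; rewrite mcoeff_mpart mcoeff1.
by case: (w =P _) => [->|_]; rewrite ?if_same // /wpar fm1.
Qed.
Fact mpart_mul s t g h :
  mpart (s (+) t) (mpart s g * mpart t h) = mpart s g * mpart t h.
Proof.
apply/malgP => w; rewrite mcoeff_mpart; case: eqP => // /eqP wst.
rewrite mcoeffMl big1 // => u _; rewrite big1 // => v _.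
case: eqP => [uv|_]; last by rewrite mulr0n.
rewrite 2!mcoeff_mpart; case: eqP => [us|_]; last by rewrite mul0r mul0rn.
case: eqP => [vt|_]; last by rewrite mulr0 mul0rn.
by case/eqP: wst; rewrite -uv -us -vt /wpar fmM count_cat oddD.
Qed.

(* The hbar-adic completion of the free K[[hbar]]-algebra on X: it is
   K<X>[[hbar]], with K<X> the free algebra, x in X having parity p x. *)
Definition cfree : topSuperAlg K :=
  seriesTSA malg_central mpart_linear mpart_part mpart_sum mpart_one mpart_mul.

Definition cvar (x : X) : cfree := hcst (<< fmu x >> : M).
End FreeSuperAlg.
Transparent mpart.

Section Quotient.
Variables (K : fieldType) (A : topSuperAlg K) (rel : A -> Prop).

Record closed_ideal (I : A -> Prop) : Prop := ClosedIdeal {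
  ideal0 : I 0;
  idealD : forall x y, I x -> I y -> I (x + y);
  idealMl : forall a x, I x -> I (a * x);
  idealMr : forall x a, I x -> I (x * a);
  ideal_part : forall s x, I x -> I (spart s x);
  ideal_closed : forall x, (forall N, exists2 y, I y & hdiv N (x - y)) -> I x
}.

(* The smallest closed two-sided graded ideal containing the relators. *)
Definition rel_ideal (x : A) : Prop :=
  forall I, closed_ideal I -> (forall r, rel r -> I r) -> I x.

Fact rel_idealP : closed_ideal rel_ideal.
Proof.
split=> [I cI rI|x y Ix Iy I cI rI|a x Ix I cI rI|x a Ix I cI rI|s x Ix I cI rI
        |x Ix I cI rI].
- exact: ideal0 cI.
- by apply: (idealD cI); [apply: Ix|apply: Iy].
- by apply: (idealMl cI); apply: Ix.
- by apply: (idealMr cI); apply: Ix.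
- by apply: (ideal_part cI); apply: Ix.
apply: (ideal_closed cI) => N; have [y Iy xy] := Ix N.
by exists y => //; apply: Iy.
Qed.
Local Notation J := rel_ideal.
Local Notation cJ := rel_idealP.

Fact uaAl a (x y : A) : a *: (x * y) = (a *: x) * y.
Proof. exact: uaScaleAl. Qed.
Fact uaAr a (x y : A) : a *: (x * y) = x * (a *: y).
Proof. exact: uaScaleAr. Qed.
Fact JZ a x : J x -> J (a *: x).
Proof. by move=> Jx; rewrite -[x]mul1r uaAl; apply: (idealMl cJ). Qed.
Fact JN x : J x -> J (- x).
Proof. by rewrite -scaleN1r; apply: JZ. Qed.
Fact JB x y : J x -> J y -> J (x - y).
Proof. by move=> Jx Jy; apply: (idealD cJ) => //; apply: JN. Qed.

Definition ideal_eqv (x y : A) : bool := `[< J (x - y) >].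
Fact ideal_eqv_equiv : equiv_class_of ideal_eqv.
Proof.
split=> [x|x y|y x z].
- by apply/asboolP; rewrite subrr; apply: (ideal0 cJ).
- by apply/asboolP/asboolP => /JN; rewrite opprB.
- move=> /asboolP xy /asboolP yz; apply/asboolP.
  by rewrite -[x](subrK y) -addrA; apply: (idealD cJ).
Qed.
Canonical ideal_equiv := EquivRelPack ideal_eqv_equiv.

Definition quot : Type := {eq_quot ideal_equiv}.
HB.instance Definition _ := Choice.on quot.

Definition qpi (x : A) : quot := \pi_({eq_quot ideal_equiv}) x.
Definition qrepr (x : quot) : A := repr (x : {eq_quot ideal_equiv}).

Fact qreprK x : qpi (qrepr x) = x. Proof. exact: reprK. Qed.
Fact qpiP x y : qpi x = qpi y <-> J (x - y).
Proof.
split=> [/eqP|xy]; last by apply/eqP; rewrite eqmodE; apply/asboolP.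
by rewrite eqmodE => /asboolP.
Qed.
Fact qrepr_pi x : J (qrepr (qpi x) - x).
Proof. by apply/qpiP; rewrite qreprK. Qed.

Definition quot_opp (x : quot) := qpi (- qrepr x).
Definition quot_add (x y : quot) := qpi (qrepr x + qrepr y).
Definition quot_mul (x y : quot) := qpi (qrepr x * qrepr y).
Definition quot_scale (r : hser K) (x : quot) := qpi (r *: qrepr x).

Fact qpiN x : quot_opp (qpi x) = qpi (- x).
Proof. by apply/qpiP; rewrite -opprD; apply: JN; apply: qrepr_pi. Qed.
Fact qpiD x y : quot_add (qpi x) (qpi y) = qpi (x + y).
Proof.
by apply/qpiP; rewrite opprD addrACA; apply: (idealD cJ); apply: qrepr_pi.
Qed.
Fact qpiM x y : quot_mul (qpi x) (qpi y) = qpi (x * y).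
Proof.
apply/qpiP; set x' := qrepr _; set y' := qrepr _.
have -> : x' * y' - x * y = (x' - x) * y' + x * (y' - y).
  by rewrite mulrBl mulrBr addrA subrK.
apply: (idealD cJ); first by apply: (idealMr cJ); apply: qrepr_pi.
by apply: (idealMl cJ); apply: qrepr_pi.
Qed.
Fact qpiZ r x : quot_scale r (qpi x) = qpi (r *: x).
Proof. by apply/qpiP; rewrite -scalerBr; apply: JZ; apply: qrepr_pi. Qed.

Fact quot_ind (P : quot -> Prop) : (forall x, P (qpi x)) -> forall x, P x.
Proof. by move=> Px x; rewrite -[x]qreprK. Qed.

Fact quot_addA : associative quot_add.
Proof. by do 3!elim/quot_ind=> ?; rewrite !qpiD addrA. Qed.
Fact quot_addC : commutative quot_add.
Proof. by do 2!elim/quot_ind=> ?; rewrite !qpiD addrC. Qed.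
Fact quot_add0 : left_id (qpi 0) quot_add.
Proof. by elim/quot_ind=> ?; rewrite !qpiD add0r. Qed.
Fact quot_addN : left_inverse (qpi 0) quot_opp quot_add.
Proof. by elim/quot_ind=> ?; rewrite qpiN qpiD addNr. Qed.
HB.instance Definition _ :=
  GRing.isZmodule.Build quot quot_addA quot_addC quot_add0 quot_addN.

Fact quot_mulA : associative quot_mul.
Proof. by do 3!elim/quot_ind=> ?; rewrite !qpiM mulrA. Qed.
Fact quot_mul1 : left_id (qpi 1) quot_mul.
Proof. by elim/quot_ind=> ?; rewrite !qpiM mul1r. Qed.
Fact quot_mulr1 : right_id (qpi 1) quot_mul.
Proof. by elim/quot_ind=> ?; rewrite !qpiM mulr1. Qed.
Fact quot_mulDl : left_distributive quot_mul +%R.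
Proof.
do 3!elim/quot_ind=> ?; rewrite -[X in quot_mul X _]/(quot_add _ _).
by rewrite -[RHS]/(quot_add _ _) !(qpiD, qpiM) mulrDl.
Qed.
Fact quot_mulDr : right_distributive quot_mul +%R.
Proof.
do 3!elim/quot_ind=> ?; rewrite -[X in quot_mul _ X]/(quot_add _ _).
by rewrite -[RHS]/(quot_add _ _) !(qpiD, qpiM) mulrDr.
Qed.
HB.instance Definition _ := GRing.Zmodule_isPzRing.Build quot
  quot_mulA quot_mul1 quot_mulr1 quot_mulDl quot_mulDr.

Fact quot_scaleA a b x : quot_scale a (quot_scale b x) = quot_scale (a * b) x.
Proof. by elim/quot_ind: x => x; rewrite !qpiZ scalerA. Qed.
Fact quot_scale1 : left_id 1 quot_scale.
Proof. by elim/quot_ind=> x; rewrite qpiZ scale1r. Qed.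
Fact quot_scaleDr : right_distributive quot_scale +%R.
Proof.
move=> a; do 2!elim/quot_ind=> ?; rewrite -[X in quot_scale _ X]/(quot_add _ _).
by rewrite -[RHS]/(quot_add _ _) !(qpiD, qpiZ) scalerDr.
Qed.
Fact quot_scaleDl x : {morph quot_scale^~ x : a b / a + b}.
Proof.
move=> a b; elim/quot_ind: x => x.
by rewrite -[RHS]/(quot_add _ _) !(qpiD, qpiZ) scalerDl.
Qed.
Fact quot_scaleAl a (x y : quot) : quot_scale a (x * y) = quot_scale a x * y.
Proof.
elim/quot_ind: x => x; elim/quot_ind: y => y.
by rewrite -![_ * _ : quot]/(quot_mul _ _) !(qpiZ, qpiM) uaAl.
Qed.
Fact quot_scaleAr a (x y : quot) : quot_scale a (x * y) = x * quot_scale a y.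
Proof.
elim/quot_ind: x => x; elim/quot_ind: y => y.
by rewrite -![_ * _ : quot]/(quot_mul _ _) !(qpiZ, qpiM) uaAr.
Qed.

Definition quotAlg : uAlg (hser K) :=
  UAlg quot_scaleA quot_scale1 quot_scaleDr quot_scaleDl quot_scaleAl
    quot_scaleAr.

(* The canonical projection. *)
Definition qproj (x : A) : quotAlg := qpi x.

Fact qproj_ind (P : quotAlg -> Prop) : (forall x, P (qproj x)) -> forall x, P x.
Proof. exact: quot_ind. Qed.
Fact qprojD : {morph qproj : x y / x + y}.
Proof. by move=> x y; rewrite [RHS]qpiD. Qed.
Fact qprojB : {morph qproj : x y / x - y}.
Proof. by move=> x y; rewrite qprojD; congr (_ + _); rewrite [RHS]qpiN. Qed.
Fact qprojM : {morph qproj : x y / x * y}.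
Proof. by move=> x y; rewrite [RHS]qpiM. Qed.
Fact qprojZ r x : qproj (r *: x) = r *: qproj x.
Proof. by rewrite [RHS]qpiZ. Qed.
Fact qproj1 : qproj 1 = 1. Proof. by []. Qed.
Fact qproj0 : qproj 0 = 0. Proof. by []. Qed.
Fact qprojP x y : qproj x = qproj y <-> J (x - y).
Proof. exact: qpiP. Qed.

Fact spartD s : {morph (@spart K A s) : x y / x + y}.
Proof. by move=> x y; have := spart_linear s 1 x y; rewrite !scale1r. Qed.
Fact spart0 s : spart s (0 : A) = 0.
Proof. by have /eqP := spartD s 0 0; rewrite addr0 -subr_eq0 opprD addNKr oppr_eq0 => /eqP. Qed.
Fact spartB s : {morph (@spart K A s) : x y / x - y}.
Proof.
move=> x y; have := spart_linear s (-1) y x.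
by rewrite !scaleN1r [- y + x]addrC [- _ + spart s x]addrC.
Qed.

Definition quot_part (s : bool) (x : quotAlg) : quotAlg :=
  qproj (spart s (qrepr x)).
Fact quot_partE s x : quot_part s (qproj x) = qproj (spart s x).
Proof.
apply/qprojP; rewrite -spartB; apply: (ideal_part cJ); exact: qrepr_pi.
Qed.

Fact quot_linear s : linear (quot_part s).
Proof.
move=> r; do 2!elim/qproj_ind=> ?; rewrite -qprojZ -qprojD.
by rewrite !quot_partE -qprojZ -qprojD spart_linear.
Qed.
Fact quot_part_part s t x :
  quot_part s (quot_part t x) = if s == t then quot_part t x else 0.
Proof.
elim/qproj_ind: x => x; rewrite !quot_partE spart_spart.
by case: ifP.
Qed.
Fact quot_sum x : quot_part false x + quot_part true x = x.
Proof.
by elim/qproj_ind: x => x; rewrite !quot_partE -qprojD spart_sum.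
Qed.
Fact quot_one : quot_part false 1 = 1.
Proof. by rewrite -qproj1 quot_partE spart_one. Qed.
Fact quot_part_mul s t x y :
  quot_part (s (+) t) (quot_part s x * quot_part t y)
  = quot_part s x * quot_part t y.
Proof.
elim/qproj_ind: x => x; elim/qproj_ind: y => y.
by rewrite (quot_partE s x) (quot_partE t y) -qprojM quot_partE spart_mul.
Qed.
Fact quot_complete : hcomplete quotAlg.
Proof.
have [_ Acomp] := tsComplete A; split=> [x|u uN].
  elim/qproj_ind: x => x xN; rewrite -[0]qproj0; apply/qprojP; rewrite subr0.
  apply: (ideal_closed cJ) => N; have [y] := xN N.
  elim/qproj_ind: y => y; rewrite -qprojZ => /qprojP Jxy.
  exists (x - hbar ^+ N *: y) => //; exists y.
  by rewrite opprB addrC subrK.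
have /choice[y yE] : forall N, exists y,
    u N.+1 - u N = hbar ^+ N *: qproj y.
  by move=> N; have [y ->] := uN N; exists (qrepr y); rewrite /qproj qreprK.
pose v N := qrepr (u 0%N) + \sum_(i < N) hbar ^+ i *: y i.
have vE N : qproj (v N) = u N.
  elim: N => [|N IH]; first by rewrite /v big_ord0 addr0 /qproj qreprK.
  by rewrite /v big_ord_recr addrA qprojD qprojZ -yE IH addrC subrK.
have [|l lN] := Acomp v.
  by move=> N; exists (y N); rewrite /v big_ord_recr addrA [X in X - _]addrC addrK.
exists (qproj l) => N; have [z zE] := lN N.
by exists (qproj z); rewrite -qprojZ -zE qprojB vE.
Qed.

Definition quotTSA : topSuperAlg K :=
  TopSuperAlg quot_linear quot_part_part quot_sum quot_one quot_part_mul
    quot_complete.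
End Quotient.

(* The complete superalgebra on the generators X, of parity p, subject to
   r = 0 for all r with [rel r]. *)
Section Presented.
Variables (K : fieldType) (X : choiceType) (p : X -> bool).
Variable rel : cfree K p -> Prop.
Definition presented : topSuperAlg K := quotTSA rel.
Definition pgen (x : X) : presented := qproj rel (cvar K p x).
End Presented.

(** * Completed tensor products and topological Hopf superalgebras *)

Section CompletedTensor.
Variables (K : fieldType) (A B : topSuperAlg K).
Local Notation R := (hser K).

Definition tgen : choiceType := (bool * bool * (A * B))%type.
Definition tpar (x : tgen) : bool := x.1.1 (+) x.1.2.

(* [tvar s t a b] stands for a_s (x) b_t, where a_s and b_t are the homogeneous
   components of a and b. *)
Definition tvar (s t : bool) (a : A) (b : B) : cfree K tpar :=
  cvar K tpar ((s, t), (a, b)).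

(* Bilinearity and the product rule
   (a (x) b)(a' (x) b') = (-1)^(|b||a'|) aa' (x) bb'. *)
Inductive ctensor_rel : cfree K tpar -> Prop :=
| ctensor_homog s t a b :
    ctensor_rel (tvar s t (spart s a) (spart t b) - tvar s t a b)
| ctensor_linl s t (r : R) a a' b :
    ctensor_rel (tvar s t (r *: a + a') b
                 - (r *: tvar s t a b + tvar s t a' b))
| ctensor_linr s t (r : R) a b b' :
    ctensor_rel (tvar s t a (r *: b + b')
                 - (r *: tvar s t a b + tvar s t a b'))
| ctensor_one : ctensor_rel (tvar false false 1 1 - 1)
| ctensor_mul s t s' t' a b a' b' :
    ctensor_rel (tvar s t a b * tvar s' t' a' b'
      - ((-1) ^+ (t && s') : R) *:
          tvar (s (+) s') (t (+) t') (spart s a * spart s' a')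
                                     (spart t b * spart t' b')).

Definition ctensor : topSuperAlg K := presented ctensor_rel.

Definition tens (a : A) (b : B) : ctensor :=
  \sum_(s : bool) \sum_(t : bool) pgen ctensor_rel ((s, t), (a, b)).

(* The linear map sending a (x) b to beta a b; it exists and is unique when V is
   complete and beta is bilinear. *)
Definition ctensor_lin (V : lmodType R) (beta : A -> B -> V) : ctensor -> V :=
  choose_with (fun=> 0)
    (fun g => linear g /\ forall a b, g (tens a b) = beta a b).
End CompletedTensor.

Record hopfMaps (K : fieldType) (A : topSuperAlg K) := HopfMaps {
  hopfDelta : A -> ctensor A A;
  hopfEps : A -> baseTSA K;
  hopfS : A -> A
}.

Section HopfAxioms.
Variables (K : fieldType) (A : topSuperAlg K) (H : hopfMaps A).
Local Notation Delta := (hopfDelta H).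
Local Notation eps := (hopfEps H).
Local Notation S := (hopfS H).

Definition ctensor_assoc :
    ctensor (ctensor A A) A -> ctensor A (ctensor A A) :=
  ctensor_lin (fun x c => ctensor_lin (fun a b => tens a (tens b c)) x).

Record is_hopf : Prop := IsHopf {
  hopf_Delta_morph : is_salg_morph Delta;
  hopf_eps_morph : is_salg_morph eps;
  hopf_S_linear : linear S;
  hopf_S_even : forall s x, S (spart s x) = spart s (S x);
  hopf_coassoc : forall x,
    ctensor_assoc (ctensor_lin (fun a b => tens (Delta a) b) (Delta x))
    = ctensor_lin (fun a b => tens a (Delta b)) (Delta x);
  hopf_counitl : forall x,
    ctensor_lin (fun a b => (eps a : hser K) *: b) (Delta x) = x;
  hopf_counitr : forall x,
    ctensor_lin (fun a b => (eps b : hser K) *: a) (Delta x) = x;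
  hopf_antipodel : forall x,
    ctensor_lin (fun a b => S a * b) (Delta x) = (eps x : hser K) *: (1 : A);
  hopf_antipoder : forall x,
    ctensor_lin (fun a b => a * S b) (Delta x) = (eps x : hser K) *: (1 : A)
}.
End HopfAxioms.

Record topHopf (K : fieldType) := TopHopf {
  hopfAlg :> topSuperAlg K;
  hopfStr : hopfMaps hopfAlg
}.

(* The deformation of H by a twist F: the superalgebra and the counit are those
   of H. *)
Section TwistDeformation.
Variables (K : fieldType) (H : topHopf K) (F : ctensor H H).

Definition twist_v : H :=
  ctensor_lin (fun a b => hopfS (hopfStr H) a * b) (rinv F).

Definition twist_deformation : topHopf K :=
  @TopHopf K H (HopfMaps
    (fun x => F * hopfDelta (hopfStr H) x * rinv F)
    (hopfEps (hopfStr H))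
    (fun x => twist_v * hopfS (hopfStr H) x * rinv twist_v)).
End TwistDeformation.

(** * Cartan super-data *)

Variant vcolor := White | Black | Grey.
Definition is_white c := if c is White then true else false.
Definition is_black c := if c is Black then true else false.
Definition is_grey c := if c is Grey then true else false.

Variant family := FamA | FamB1 | FamB2 | FamC | FamD1 | FamD2 | FamF4 | FamG3.

(* Throughout, vertex number i of a diagram is the ordinal i - 1. *)
Definition dynkin_colors (fam : family) (n : nat) (col : 'I_n -> vcolor) : Prop :=
  match fam with
  | FamA => (0 < n)%N /\ forall i : 'I_n, ~~ is_black (col i)
  | FamB1 => (0 < n)%N /\ forall i : 'I_n,
      if i.+1 == n then is_white (col i) else ~~ is_black (col i)
  | FamB2 => (0 < n)%N /\ forall i : 'I_n,
      if i.+1 == n then is_black (col i) else ~~ is_black (col i)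
  | FamC => (1 < n)%N /\ forall i : 'I_n,
      if i.+1 == n then is_white (col i) else ~~ is_black (col i)
  | FamD1 => (2 < n)%N /\ forall i : 'I_n,
      if (n <= i.+2)%N then is_white (col i) else ~~ is_black (col i)
  | FamD2 => (2 < n)%N /\ forall i : 'I_n,
      if (n <= i.+2)%N then is_grey (col i) else ~~ is_black (col i)
  | FamF4 => n = 4 /\ forall i : 'I_n,
      if i == 1%N :> nat then is_grey (col i) else is_white (col i)
  | FamG3 => n = 3 /\ forall i : 'I_n,
      if i == 0%N :> nat then is_grey (col i) else is_white (col i)
  end.

(* [sdSign] is the parity of the sign (e_1, e_1), which the diagram does not
   determine. *)
Record superDatum (n : nat) := SuperDatum {
  sdFam : family;
  sdCol : 'I_n -> vcolor;
  sdSign : bool;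
  sdOk : dynkin_colors sdFam sdCol
}.

Section CartanDatum.
Variables (n : nat) (D : superDatum n).
Local Notation fam := (sdFam D).
Local Notation col := (sdCol D).

Definition sdPar (i : 'I_n) : bool := ~~ is_white (col i).

(* [sqlen l] is (e_(l+1), e_(l+1)); the sign changes across each grey vertex. *)
Definition sqlen (l : nat) : int :=
  (-1) ^+ (sdSign D + \sum_(i < n | (i < l)%N) is_grey (col i))%N.

(* Coefficient of e_(l+1) in beta_(i+1), in types A-D. *)
Definition beta (i l : nat) : int :=
  if (i.+1 < n)%N then (l == i)%:R - (l == i.+1)%:R else
  match fam with
  | FamA => (l == i)%:R - (l == i.+1)%:R
  | FamB1 | FamB2 => (l == i)%:R
  | FamC => 2 * (l == i)%:R
  | FamD1 | FamD2 => (l == i.-1)%:R + (l == i)%:R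
  | FamF4 | FamG3 => 0
  end.

Definition bform (i j : nat) : int := \sum_(l < n.+1) sqlen l * beta i l * beta j l.

Definition classical_cartan (i j : 'I_n) : int :=
  if is_grey (col i) then
    (if (if fam is FamD2 then i.+1 == n else false) then sqlen i.-1 else sqlen i)
    * bform i j
  else (* the division is exact *)
    (2 * bform i j %/ bform i i)%Z.

Definition table_cartan (rows : seq (seq int)) (i j : nat) : int :=
  nth 0 (nth [::] rows i) j.

Definition cartan (i j : 'I_n) : int :=
  match fam with
  | FamF4 => table_cartan
      [:: [:: 2; 0; 0; -1]; [:: 0; 0; 1; 0]; [:: 0; -1; 2; -2]; [:: -1; 0; -1; 2]]
      i j
  | FamG3 => table_cartan [:: [:: 0; 0; 1]; [:: 0; 2; -1]; [:: -1; -3; 2]] i j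
  | _ => classical_cartan i j
  end.

Definition symmetrizer (d : 'I_n -> rat) : Prop :=
  [/\ forall i, d i != 0 /\ 2 * d i \is a Num.int,
      forall i j, d i * (cartan i j)%:~R \is a Num.int &
      forall i j, d i * (cartan i j)%:~R = d j * (cartan j i)%:~R].

Definition minimal_symmetrizer (d : 'I_n -> rat) : Prop :=
  [/\ symmetrizer d,
      forall d', symmetrizer d' -> forall i, `|d i| <= `|d' i| &
      match fam with
      | FamF4 | FamG3 => True
      | _ => exists2 c : rat, 0 < c &
               forall i j, d i * (cartan i j)%:~R = c * (bform i j)%:~R
      end].

(* The exponents (eps_i) of the nu_i = q^(eps_i), from index 0 on. *)
Definition nu_exp (i : nat) : int :=
  match fam with
  | FamF4 => nth 0 [:: 6; -2; -2; -2] i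
  | FamG3 => nth 0 [:: -2; 2; 6] i
  | _ => sqlen i
  end.

(* [bond i j] is the way in which vertex i, drawn on the left, is joined to
   vertex j, drawn on the right; [DoubleR] is i => j, [DoubleL] is i <= j,
   [Double] is an undirected double edge, [TripleL] is i <= j with a triple
   edge. *)
Variant bond_kind := NoBond | Simple | DoubleR | DoubleL | Double | TripleL.

Definition bond (i j : nat) : bond_kind :=
  match fam with
  | FamA => if j == i.+1 then Simple else NoBond
  | FamB1 | FamB2 =>
      if j == i.+1 then (if j.+1 == n then DoubleR else Simple) else NoBond
  | FamC =>
      if j == i.+1 then (if j.+1 == n then DoubleL else Simple) else NoBond
  | FamD1 =>
      if (j == i.+1) && (j.+1 != n) || (j == i.+2) && (j.+1 == n)
      then Simple else NoBond
  | FamD2 =>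
      if (j == i.+1) && (j.+1 != n) || (j == i.+2) && (j.+1 == n) then Simple
      else if (j == i.+1) && (j.+1 == n) then Double else NoBond
  | FamF4 =>
      match i, j with
      | 0, 3 | 2, 1 => Simple | 3, 2 => DoubleR | _, _ => NoBond
      end
  | FamG3 =>
      match i, j with 0, 2 => Simple | 2, 1 => TripleL | _, _ => NoBond end
  end.

(* x_i - (x)_j - x_k, x_i - (x)_j => o_k or x_i - (x)_j => x_k. *)
Definition cubic_config (i j k : 'I_n) : bool :=
  [&& ~~ is_black (col i), is_grey (col j),
      (if bond i j is Simple then true else false) &
      match bond j k with
      | Simple => ~~ is_black (col k)
      | DoubleR => true
      | _ => false
      end].
End CartanDatum.

(** * Realizations *)

Section Realizations.
Variables (K : fieldType) (n : nat) (h : lmodType (hser K)).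
Local Notation R := (hser K).

Record realization := Realization {
  rTp : 'I_n -> h;
  rTm : 'I_n -> h;
  rAlpha : 'I_n -> {scalar h}
}.

Definition is_basis (t : nat) (H : 'I_t -> h) : Prop :=
  forall x, exists! c : {ffun 'I_t -> R}, x = \sum_g c g *: H g.

Definition is_realization (P : 'M[R]_n) (rz : realization) : Prop :=
  [/\ exists t (H : 'I_t -> h), is_basis H,
      forall i j, rAlpha rz j (rTp rz i) = P i j,
      forall i j, rAlpha rz j (rTm rz i) = P j i &
      (* the classes of the S_i in h / hbar h are linearly independent *)
      forall c : 'I_n -> K,
        hdiv 1 (\sum_i hcst (c i) *:
                  (hcst 2^-1 *: (rTp rz i + rTm rz i)) : h) ->
        forall i, c i = 0].

(* The classes of the alpha_i in h^* / hbar h^* are linearly independent. *)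
Definition straight (rz : realization) : Prop :=
  forall c : 'I_n -> K,
    (exists b : {scalar h},
       forall x, \sum_i hcst (c i) * rAlpha rz i x = hbar * b x) ->
    forall i, c i = 0.

Section Twist.
Variables (t : nat) (H : 'I_t -> h) (Phi : 'M[R]_t).

Definition alphaH (rz : realization) : 'M[R]_(n, t) :=
  \matrix_(i, g) rAlpha rz i (H g).

Definition twist_matrix (rz : realization) (P : 'M[R]_n) : 'M[R]_n :=
  P - alphaH rz *m Phi *m (alphaH rz)^T.

Definition twist_shift (rz : realization) (i : 'I_n) : h :=
  \sum_g \sum_k (rAlpha rz i (H g) * Phi k g) *: H k.

Definition twist_realization (rz : realization) : realization :=
  Realization (fun i => rTp rz i + twist_shift rz i)
              (fun i => rTm rz i - twist_shift rz i)
              (rAlpha rz).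
End Twist.
End Realizations.

Definition cartan_matrix_P (K : fieldType) (n : nat) (D : superDatum n)
    (d : 'I_n -> rat) : 'M[hser K]_n :=
  \matrix_(i, j) hcst (ratr (d i * (cartan D i j)%:~R)).

(** * The formal multiparameter quantum universal enveloping superalgebra *)

Section QNumbers.
Variable K : fieldType.
Local Notation R := (hser K).

(* e^(hbar x) for a scalar x. *)
Definition scalar_exp (x : R) : R := hexp (A := baseTSA K) x.

Variable q : R.
Definition qint (m : nat) : R := \sum_(l < m) q ^+ (m.-1 - l) * rinv q ^+ l.
Definition qfact (m : nat) : R := \prod_(l < m) qint l.+1.
(* qint m reduces to m modulo hbar, hence is invertible in characteristic 0. *)
Definition qbin (m s : nat) : R := qfact m * rinv (qfact s * qfact (m - s)).
End QNumbers.

Section FoMpQUESA.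
Variables (K : fieldType) (n : nat) (D : superDatum n) (d : 'I_n -> rat).
Variables (P : 'M[hser K]_n) (h : lmodType (hser K)) (rz : realization n h).
Local Notation R := (hser K).
Local Notation p := (sdPar D).
Local Notation a := (cartan D).

Definition fgen : choiceType := (h + ('I_n + 'I_n))%type.
Definition gT (T : h) : fgen := inl T.
Definition gE (i : 'I_n) : fgen := inr (inl i).
Definition gF (i : 'I_n) : fgen := inr (inr i).
Definition fpar (x : fgen) : bool :=
  match x with inl _ => false | inr (inl i) => p i | inr (inr i) => p i end.

Local Notation Free := (cfree K fpar).
Local Notation T_ x := (cvar K fpar (gT x)).
Local Notation E_ i := (cvar K fpar (gE i)).
Local Notation F_ i := (cvar K fpar (gF i)).

Definition q_ (i : 'I_n) : R := scalar_exp (hcst (ratr (d i))).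
Definition k_ (i j : 'I_n) : R := scalar_exp (hcst 2^-1 * (P i j - P j i)).
Definition nu_ (i : nat) : R := scalar_exp (hcst (nu_exp D i)%:~R).

(* X = E for e = true, X = F for e = false. *)
Definition X_ (e : bool) (i : 'I_n) : Free := if e then E_ i else F_ i.
Definition kX (e : bool) (i j : 'I_n) : R := if e then k_ i j else k_ j i.

(* A homogeneous combination of products of the X_i's, together with the
   multiplicities of the X_i's in it. *)
Definition welt : Type := Free * ('I_n -> nat).
Definition wX (e : bool) (i : 'I_n) : welt := (X_ e i, fun j => (j == i) : nat).
Definition welt_par (x : welt) : bool := odd (\sum_i x.2 i * p i)%N.
Definition br (e : bool) (nu : R) (x y : welt) : welt :=
  (x.1 * y.1
   - ((-1) ^+ (welt_par x && welt_par y) * nu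
      * \prod_i \prod_j kX e i j ^+ (x.2 i * y.2 j)%N) *: (y.1 * x.1),
   fun i => (x.2 i + y.2 i)%N).

Inductive fomp_rel : Free -> Prop :=
| rel_lin r T T' : fomp_rel (T_ (r *: T + T') - (r *: T_ T + T_ T'))
| rel_TT T T' : fomp_rel (T_ T * T_ T' - T_ T' * T_ T)
| rel_TE T j : fomp_rel (T_ T * E_ j - E_ j * T_ T - rAlpha rz j T *: E_ j)
| rel_TF T j : fomp_rel (T_ T * F_ j - F_ j * T_ T + rAlpha rz j T *: F_ j)
(* w is (e^(hbar T_i^+) - e^(-hbar T_i^-)) / (q_i - q_i^-1): the free complete
   algebra has no torsion, so that w is unique. *)
| rel_EF i j w :
    (q_ i - rinv (q_ i)) *: w = hexp (T_ (rTp rz i)) - hexp (- T_ (rTm rz i)) ->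
    fomp_rel (E_ i * F_ j - ((-1) ^+ (p i && p j) : R) *: (F_ j * E_ i)
              - ((i == j)%:R : R) *: w)
| rel_serre e i j : i != j -> p i = false ->
    let m := `|1 - a i j|%N in
    fomp_rel (\sum_(s < m.+1)
      ((-1) ^+ s * qbin (q_ i) m s * kX e i j ^+ s) *:
        (X_ e i ^+ (m - s) * X_ e j * X_ e i ^+ s))
| rel_zero e i j : a i j = 0 -> fomp_rel (br e 1 (wX e i) (wX e j)).1
| rel_cubic e (i j k : 'I_n) : cubic_config D i j k ->
    fomp_rel
      (br e 1 (br e (nu_ j.+1) (br e (nu_ j) (wX e i) (wX e j)) (wX e k))
              (wX e j)).1
| rel_B e (i j : 'I_n) :
    sdFam D = FamB2 -> i.+1 = j -> j.+1 = n ->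
    fomp_rel
      (br e (rinv (nu_ j)) (br e 1 (br e (nu_ j) (wX e i) (wX e j)) (wX e j))
                           (wX e j)).1
(* The two sides order X_j and X_k differently, whence the factor k_jk (which
   is 1 when P is symmetric): it makes the relation stable under twisting. *)
| rel_D e (i j k : 'I_n) :
    sdFam D = FamD2 -> i.+1 = j -> j.+1 = k -> k.+1 = n ->
    fomp_rel
      ((br e (nu_ k) (br e (nu_ j) (wX e i) (wX e j)) (wX e k)).1
       - kX e j k *: (br e (nu_ k) (br e (nu_ j) (wX e i) (wX e k)) (wX e j)).1)
| rel_C3 e (i j k : 'I_n) :
    sdFam D = FamC -> i.+1 = j -> j.+1 = k -> k.+1 = n ->
    is_grey (sdCol D i) -> is_grey (sdCol D j) ->
    let Y := br e (nu_ j) (wX e i) (wX e j) in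
    fomp_rel
      (br e (nu_ j) (br e 1 (br e (nu_ k) Y (wX e k)) Y) (wX e j)).1
| rel_C4 e (l i j k : 'I_n) :
    sdFam D = FamC -> l.+1 = i -> i.+1 = j -> j.+1 = k -> k.+1 = n ->
    is_grey (sdCol D i) -> is_grey (sdCol D j) ->
    let Y := br e (nu_ k) (br e (nu_ j) (br e (nu_ i) (wX e l) (wX e i))
                                        (wX e j)) (wX e k) in
    fomp_rel
      (br e 1 (br e (nu_ j) (br e (nu_ k) Y (wX e j)) (wX e i)) (wX e j)).1.

Definition fomp : topSuperAlg K := presented fomp_rel.

Definition fT (T : h) : fomp := pgen fomp_rel (gT T).
Definition fE (i : 'I_n) : fomp := pgen fomp_rel (gE i).
Definition fF (i : 'I_n) : fomp := pgen fomp_rel (gF i).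

Definition std_hopf_values (S : hopfMaps fomp) : Prop :=
  (forall i,
    [/\ hopfDelta S (fE i) = tens (fE i) 1 + tens (hexp (fT (rTp rz i))) (fE i),
        hopfDelta S (fF i) = tens (fF i) (hexp (- fT (rTm rz i))) + tens 1 (fF i),
        hopfEps S (fE i) = 0 /\ hopfEps S (fF i) = 0,
        hopfS S (fE i) = - (hexp (- fT (rTp rz i)) * fE i) &
        hopfS S (fF i) = - (fF i * hexp (fT (rTm rz i)))]) /\
  (forall T,
    [/\ hopfDelta S (fT T) = tens (fT T) 1 + tens 1 (fT T),
        hopfEps S (fT T) = 0 & hopfS S (fT T) = - fT T]).

(* The Hopf structure with the standard values on generators.  It is unique; it
   exists (Yamane) when P = DA and rz is straight. *)
Definition fomp_hopf : topHopf K :=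
  TopHopf (choose_with (HopfMaps (fun=> 0) (fun=> 0) (fun=> 0))
             (fun S => is_hopf S /\ std_hopf_values S)).

Section ToralTwist.
Variables (t : nat) (H : 'I_t -> h) (Phi : 'M[R]_t).

Definition toral_twist : ctensor fomp fomp :=
  hexp (hcst 2^-1 *: \sum_g \sum_k Phi g k *: tens (fT (H g)) (fT (H k))).

Definition twistL (i : 'I_n) : fomp :=
  hexp (hcst 2^-1 *:
    \sum_g \sum_k (rAlpha rz i (H g) * Phi g k) *: fT (H k)).

Definition twistK (i : 'I_n) : fomp :=
  hexp (hcst 2^-1 *:
    \sum_g \sum_k (rAlpha rz i (H g) * Phi k g) *: fT (H k)).
End ToralTwist.
End FoMpQUESA.

(* Main.v *)
Require Import Defs.
From mathcomp Require Import all_boot all_order all_algebra.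
From mathcomp Require Import boolp.
From mathcomp Require Import finmap monalg.
From mathcomp Require Import ring.

Set Implicit Arguments.
Unset Strict Implicit.
Unset Printing Implicit Defensive.

Import Order.TTheory GRing.Theory Num.Theory.
Local Open Scope ring_scope.

(** The twist changes the coproduct and the antipode only, so the target of the
    isomorphism is, as an algebra, the untwisted algebra [U]; the task is to
    compare two algebras given by generators and relations.  Put
    [Z_i = (1/2) sum_(g, k) alpha_i (H_g) phi_(k g) H_k].  The map sends [E_i] to
    [e^(hbar Z_i) E_i] and [F_i] to [F_i e^(hbar Z_i) = e^(hbar Z_i) F_i], and
    everything rests on the antisymmetry of the matrix [c_(i j) = alpha_j (Z_i)].

    Relations that are homogeneous in the [E]'s, or in the [F]'s.  Since
    [E_j e^(hbar Z_i) = e^(- hbar c_(i j)) e^(hbar Z_i) E_j], a product of twisted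
    expressions of multidegrees [a] and [b] is the untwisted product, multiplied
    on the left by [e^(hbar (Z_a + Z_b))] and by the exponential of the scalar
    [hbar c (a, b)], where [c] is extended to an alternating form; for the [F]'s
    the sign of [c] changes.  Reversing the two factors inverts that scalar,
    and the factor [k_(i j)] of the brackets changes under the twist by exactly
    [e^(2 hbar c_(i j))], so both terms of a twisted bracket carry the same scalar
    ([twists_bracket]).  By induction every iterated bracket of twisted generators
    is an invertible multiple of the untwisted one ([br_twists]), and the same
    count works for the quantum Serre sums ([serre_twists]) and for the relation
    of type D with two orderings ([phi_D2]).

    The relation between [E_i] and [F_i].  Twisting turns its right-hand side into
    [e^(2 hbar Z_i)] times the old one, because [T_i^+] becomes [T_i^+ + 2 Z_i]
    and [T_i^-] becomes [T_i^- - 2 Z_i].  The quotient by [q_i - q_i^-1] is taken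
    in the torsion-free free algebra, whereas [U] could a priori have torsion; the
    identity is therefore proved for the series [(e^(hbar x) - 1) / hbar]
    ([hexpm1], [phi_EF]).

    Bijectivity.  The situation is symmetric: [U] is obtained from the twisted
    algebra by the twist with [- Z] ([toral_pair_sym]).  The two resulting
    homomorphisms are inverse to each other on generators, hence everywhere.

    The preliminaries are the calculus of [hbar]-adically convergent series, in
    which exponentials are handled coefficientwise by Cauchy products, and the
    universal property of complete algebras given by generators and relations
    ([presented_lift], [presented_ext]). *)

(** * Convergent series *)

Section LinearFacts.
Variables (R : nzRingType) (V W : lmodType R) (f : V -> W).
Hypothesis lf : linear f.

Lemma linear_add : {morph f : x y / x + y}.
Proof. by move=> x y; have := lf 1 x y; rewrite !scale1r. Qed.

Lemma linear_zero : f 0 = 0.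
Proof. by apply: (addrI (f 0)); rewrite -linear_add !addr0. Qed.

Lemma linear_scale c : {morph f : x / c *: x}.
Proof. by move=> x; have := lf c x 0; rewrite linear_zero !addr0. Qed.

Lemma linear_opp : {morph f : x / - x}.
Proof. by move=> x; rewrite -!scaleN1r linear_scale. Qed.

Lemma linear_sub : {morph f : x y / x - y}.
Proof. by move=> x y; rewrite linear_add linear_opp. Qed.

Lemma linear_bigsum (I : Type) (r : seq I) (Q : pred I) (F : I -> V) :
  f (\sum_(i <- r | Q i) F i) = \sum_(i <- r | Q i) f (F i).
Proof. exact: (big_morph _ linear_add linear_zero). Qed.
End LinearFacts.

Section Hdiv.
Variables (K : fieldType) (V : lmodType (hser K)).
Implicit Types (x y : V) (u v : nat -> V).

Lemma hdiv_scale N x : hdiv N (hbar ^+ N *: x).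
Proof. by exists x. Qed.

Lemma hdiv0 N : hdiv N (0 : V).
Proof. by exists 0; rewrite scaler0. Qed.

Lemma hdivD N x y : hdiv N x -> hdiv N y -> hdiv N (x + y).
Proof. by move=> [a ->] [b ->]; exists (a + b); rewrite scalerDr. Qed.

Lemma hdivN N x : hdiv N x -> hdiv N (- x).
Proof. by move=> [a ->]; exists (- a); rewrite scalerN. Qed.

Lemma hdivB N x y : hdiv N x -> hdiv N y -> hdiv N (x - y).
Proof. by move=> hx /hdivN; apply: hdivD. Qed.

Lemma hdiv_sum N (I : Type) (r : seq I) (F : I -> V) :
  (forall i, hdiv N (F i)) -> hdiv N (\sum_(i <- r) F i).
Proof.
by move=> hF; elim/big_rec: _ => [|i x _ hx]; [apply: hdiv0|apply: hdivD].
Qed.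

Lemma hdiv_linear (W : lmodType (hser K)) (f : V -> W) N x :
  linear f -> hdiv N x -> hdiv N (f x).
Proof. by move=> lf [y ->]; exists (f y); rewrite linear_scale. Qed.

Definition is_hlim u y : Prop :=
  forall N, hdiv N (y - \sum_(i < N) hbar ^+ i *: u i).

Definition hseries u : V := choose_with 0 (is_hlim u).

Hypothesis V_complete : hcomplete V.

Lemma hseriesP u : is_hlim u (hseries u).
Proof.
rewrite /hseries /choose_with; case: pselect => [e|[]]; first by case: cid.
have [_ Vlim] := V_complete.
have [|l lP] := Vlim (fun N => \sum_(i < N) hbar ^+ i *: u i); last by exists l.
by move=> N; rewrite big_ord_recr addrAC subrr add0r; apply: hdiv_scale.
Qed.

Lemma hdiv_eq x y : (forall N, hdiv N (x - y)) -> x = y.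
Proof. by have [V0 _] := V_complete => /V0 /eqP; rewrite subr_eq0 => /eqP. Qed.

Lemma hseries_eq u y : is_hlim u y -> hseries u = y.
Proof.
move=> uy; apply: hdiv_eq => N.
have := hdivB (hseriesP u N) (uy N).
by rewrite opprB addrA subrK.
Qed.

Lemma eq_hseries u v : u =1 v -> hseries u = hseries v.
Proof. by move=> /funext ->. Qed.

Lemma hseriesD u v : hseries (fun i => u i + v i) = hseries u + hseries v.
Proof.
apply: hseries_eq => N; under eq_bigr do rewrite scalerDr.
by rewrite big_split opprD addrACA; apply: hdivD; apply: hseriesP.
Qed.

Lemma hseries_recl u : hseries u = u 0%N + hbar *: hseries (fun i => u i.+1).
Proof.
apply: hseries_eq => -[|N].
  by rewrite big_ord0 subr0; exists (u 0%N + hbar *: hseries (fun i => u i.+1));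
     rewrite expr0 scale1r.
rewrite big_ord_recl expr0 scale1r opprD addrACA subrr add0r.
under eq_bigr do rewrite lift0 exprS -scalerA.
rewrite -scaler_sumr -scalerBr.
have [y ->] := hseriesP (fun i => u i.+1) N.
by exists y; rewrite exprS scalerA.
Qed.

Lemma triangular_sum (F : nat -> nat -> V) N :
  \sum_(i < N) \sum_(j < N - i) F i j
  = \sum_(m < N) \sum_(i < m.+1) F i (m - i)%N.
Proof.
elim: N => [|N IH]; first by rewrite !big_ord0.
rewrite [RHS]big_ord_recr /= -IH big_ord_recr /=.
rewrite [X in _ = X + _](_ : _ = \sum_(i < N) \sum_(j < N - i) F i j) //.
rewrite [in RHS]big_ord_recr /= addrA; congr (_ + _); last first.
  by rewrite subSnn subnn big_ord1.
rewrite -big_split; apply: eq_bigr => i _ /=.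
by rewrite subSn 1?ltnW // big_ord_recr.
Qed.

(** Two nested series may be summed along the diagonals [i + j = m]: up to any
    power of [hbar] both sides are the same finite triangular sum. *)
Lemma hseries_hseries (w : nat -> nat -> V) :
  hseries (fun i => hseries (w i))
  = hseries (fun m => \sum_(i < m.+1) w i (m - i)%N).
Proof.
apply: esym; apply: hseries_eq => N.
have := hseriesP (fun i => hseries (w i)) N; set s := hseries _ => hs.
rewrite -[s](subrK (\sum_(i < N) hbar ^+ i *: hseries (w i))) -addrA.
apply: hdivD => //.
have -> : \sum_(m < N) hbar ^+ m *: (\sum_(i < m.+1) w i (m - i)%N)
  = \sum_(i < N) \sum_(j < N - i) hbar ^+ (i + j) *: w i j.
  rewrite (triangular_sum (fun i j => hbar ^+ (i + j) *: w i j)).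
  apply: eq_bigr => m _; rewrite scaler_sumr.
  by apply: eq_bigr => i _; rewrite subnKC // -ltnS.
rewrite -sumrB; apply: hdiv_sum => i.
under eq_bigr do rewrite exprD -scalerA.
rewrite -scaler_sumr -scalerBr; have [y ->] := hseriesP (w i) (N - i)%N.
by exists y; rewrite scalerA -exprD subnKC // ltnW.
Qed.
End Hdiv.

Lemma hseries_linear (K : fieldType) (V W : lmodType (hser K)) (f : V -> W) u :
  hcomplete V -> hcomplete W -> linear f ->
  f (hseries u) = hseries (fun i => f (u i)).
Proof.
move=> cV cW lf; apply: esym; apply: hseries_eq => // N.
have -> : \sum_(i < N) hbar ^+ i *: f (u i) = f (\sum_(i < N) hbar ^+ i *: u i).
  by rewrite (linear_bigsum lf); apply: eq_bigr => i _; rewrite (linear_scale lf).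
by rewrite -(linear_sub lf); apply: hdiv_linear lf _; apply: hseriesP.
Qed.

Section SeriesInAlgebra.
Variables (K : fieldType) (A : topSuperAlg K).
Local Notation R := (hser K).
Local Notation cA := (tsComplete A).
Implicit Types (x y : A) (u v : nat -> A).

Lemma lmul_linear x : linear (fun y : A => x * y).
Proof. by move=> r y z; rewrite mulrDr uaAr. Qed.

Lemma rmul_linear x : linear (fun y : A => y * x).
Proof. by move=> r y z; rewrite mulrDl uaAl. Qed.

Lemma scale_linear (V : lmodType R) (x : V) : linear (fun r : baseTSA K => r *: x).
Proof. by move=> r s t; rewrite scalerDl -scalerA. Qed.

Lemma scaleM (a b : R) x y : (a *: x) * (b *: y) = (a * b) *: (x * y).
Proof. by rewrite -uaAl -uaAr scalerA. Qed.

Lemma hseriesM u v :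
  hseries u * hseries v = hseries (fun m => \sum_(i < m.+1) u i * v (m - i)%N).
Proof.
rewrite -(hseries_hseries cA (fun i j => u i * v j)).
rewrite (hseries_linear u cA cA (rmul_linear (hseries v))).
apply: eq_hseries => i.
exact: (hseries_linear v cA cA (lmul_linear (u i))).
Qed.

Lemma hser_coefs (r : R) :
  r = hseries (fun i => hcst (hcoef r i) : baseTSA K).
Proof.
apply: esym; apply: (hseries_eq (tsComplete (baseTSA K))) => N.
have [y yE] := hsumE (fun i => hcst (hcoef r i)) N; exists y.
rewrite -[RHS]yE; congr (_ - _); apply: hserP => m /=.
rewrite big_ord_recr /= subnn big1 ?add0r //= => i _.
by case: (m - i)%N (subn_gt0 i m) => //; rewrite ltn_ord.
Qed.

Lemma hseriesZ (V : lmodType R) (cV : hcomplete V) (r : R) (v : nat -> V) :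
  r *: hseries v
  = hseries (fun m => \sum_(i < m.+1) hcst (hcoef r i) *: v (m - i)%N).
Proof.
rewrite -(hseries_hseries cV (fun i j => hcst (hcoef r i) *: v j)).
rewrite {1}[r]hser_coefs.
rewrite (hseries_linear _ (tsComplete (baseTSA K)) cV (scale_linear (hseries v))).
apply: eq_hseries => i; apply: (hseries_linear v cV cV).
by move=> s a b; rewrite scalerDr !scalerA mulrC.
Qed.
End SeriesInAlgebra.

(** * Exponentials *)

Section Constants.
Variable B : nzRingType.

Lemma hcst0 : hcst 0 = 0 :> hser B.
Proof. by apply: hserP => -[|m]. Qed.

Lemma hcst1 : hcst 1 = 1 :> hser B.
Proof. by []. Qed.

Lemma hcstM (a b : B) : hcst (a * b) = hcst a * hcst b.
Proof.
apply: hserP => m; rewrite hcoefM big_ord_recl /= subn0 big1 => [|i _].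
  by rewrite addr0; case: m => //=; rewrite mulr0.
by rewrite mul0r.
Qed.

Lemma hcstD (a b : B) : hcst (a + b) = hcst a + hcst b.
Proof. by apply: hserP => -[|m] //=; rewrite addr0. Qed.

Lemma hcst_nat k : hcst k%:R = k%:R :> hser B.
Proof.
elim: k => [|k IH]; first exact: hcst0.
by rewrite -[k.+1%:R]natr1 hcstD IH hcst1 natr1.
Qed.
End Constants.

Section ExpSeries.
Variables (K : fieldType) (A : topSuperAlg K).
Local Notation R := (hser K).
Local Notation cA := (tsComplete A).
Implicit Types (x y : A).

Definition exp_term x i : A := hcst (i`!%:R)^-1 *: x ^+ i.

Lemma exp_term0 x : exp_term x 0 = 1.
Proof. by rewrite /exp_term expr0 invr1 hcst1 scale1r. Qed.

Lemma hexpE x : hexp x = hseries (exp_term x).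
Proof.
have exp_lim y : is_hexp x y <-> is_hlim (exp_term x) y.
  suff -> : is_hexp x y = is_hlim (exp_term x) y by [].
  apply: eq_forall => N; congr (hdiv N (y - _)).
  by apply: eq_bigr => i _; rewrite scalerA mulrC.
rewrite /hexp /choose_with; case: pselect => [e|[]].
  by case: cid => y yP /=; apply/esym/(hseries_eq cA)/exp_lim.
by exists (hseries (exp_term x)); apply/exp_lim/(hseriesP cA).
Qed.

Lemma hexp0 : hexp (0 : A) = 1.
Proof.
rewrite hexpE (hseries_recl cA) exp_term0.
rewrite (hseries_eq cA (y := 0)) ?scaler0 ?addr0 // => N.
by rewrite big1 ?subrr => [|i _]; [apply: hdiv0|rewrite /exp_term expr0n /= !scaler0].
Qed.

(** [(exp (hbar x) - 1) / hbar], which makes sense although [A] may have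
    torsion. *)
Definition hexpm1 x : A := hseries (fun i => exp_term x i.+1).

Lemma hexp_hexpm1 x : hexp x = 1 + hbar *: hexpm1 x.
Proof. by rewrite hexpE (hseries_recl cA) exp_term0. Qed.

Lemma spart_hseries s (u : nat -> A) :
  spart s (hseries u) = hseries (fun i => spart s (u i)).
Proof. exact: (hseries_linear u cA cA (spart_linear s)). Qed.

Lemma even_exp_term x i : spart false x = x -> spart false (exp_term x i) = exp_term x i.
Proof.
move=> ex; rewrite /exp_term (linear_scale (spart_linear false)); congr (_ *: _).
elim: i => [|i IH]; first by rewrite expr0 spart_one.
by rewrite exprS -{1}ex -{1}IH (spart_mul false false) ex IH.
Qed.

Lemma even_hexp x : spart false x = x -> spart false (hexp x) = hexp x.
Proof.
move=> ex; rewrite hexpE spart_hseries.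
by apply: eq_hseries => i; apply: even_exp_term.
Qed.

(** This is how exponentials of Cartan elements are moved across root vectors:
    there [x'] is [x] minus a scalar. *)
Lemma hexp_intertwine x x' y : y * x = x' * y -> y * hexp x = hexp x' * y.
Proof.
move=> yx; rewrite !hexpE.
rewrite (hseries_linear _ cA cA (lmul_linear y)).
rewrite (hseries_linear _ cA cA (rmul_linear y)).
apply: eq_hseries => i; rewrite /exp_term -uaAl -uaAr; congr (_ *: _).
elim: i => [|i IH]; first by rewrite mulr1 mul1r.
by rewrite exprSr mulrA IH -mulrA yx mulrA -exprSr.
Qed.

Hypothesis charK : [pchar K] =i pred0.

Lemma exp_termD x y m : GRing.comm x y ->
  exp_term (x + y) m = \sum_(i < m.+1) exp_term x i * exp_term y (m - i)%N.
Proof.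
move=> cxy; have cyx : GRing.comm y x by [].
rewrite /exp_term addrC exprDn_comm // scaler_sumr.
apply: eq_bigr => i _; have im : (i <= m)%N by rewrite -ltnS.
rewrite -uaAl -uaAr scalerA -scaler_nat scalerA -hcst_nat -!hcstM.
congr (hcst _ *: _); last by apply: commrX; apply/commr_sym/commrX.
have nz k : (k`!%:R : K) != 0.
  by have /pcharf0P -> := charK; rewrite -lt0n fact_gt0.
have nzC : ('C(m, i)%:R : K) != 0.
  by have /pcharf0P -> := charK; rewrite -lt0n bin_gt0.
by rewrite -(bin_fact im) !natrM !invfM mulrAC mulVf // mul1r.
Qed.

Lemma hexpD x y : GRing.comm x y -> hexp (x + y) = hexp x * hexp y.
Proof.
move=> cxy; rewrite !hexpE hseriesM.
by apply: eq_hseries => m; apply: exp_termD.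
Qed.

Lemma hexpNr x : hexp x * hexp (- x) = 1.
Proof. by rewrite -hexpD ?subrr ?hexp0 //; apply: commrN. Qed.

(** The coefficients come from the binomial formula for [(x + y) ^ m.+1]: the
    term free of [x] contributes to [hexpm1 y], the others to the product. *)
Lemma hexpm1D x y : GRing.comm x y ->
  hexpm1 (x + y) = hexp y * hexpm1 x + hexpm1 y.
Proof.
move=> cxy; rewrite hexpE hseriesM -(hseriesD cA).
apply: eq_hseries => m; rewrite addrC exp_termD // big_ord_recr subnn /=.
rewrite exp_term0 mulr1; congr (_ + _).
by apply: eq_bigr => i _; rewrite subSn // -ltnS.
Qed.

Lemma hexpm1B x y z : GRing.comm x z -> GRing.comm y z ->
  hexpm1 (x + z) - hexpm1 (y + z) = hexp z * (hexpm1 x - hexpm1 y).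
Proof.
by move=> cxz cyz; rewrite !hexpm1D // mulrBr opprD addrACA subrr addr0.
Qed.
End ExpSeries.

Section ExpMorphism.
Variables (K : fieldType) (A B : topSuperAlg K) (f : A -> B).
Hypotheses (lf : linear f) (f1 : f 1 = 1) (fM : {morph f : x y / x * y}).

Lemma morph_exp_term x i : f (exp_term x i) = exp_term (f x) i.
Proof.
rewrite /exp_term (linear_scale lf); congr (_ *: _).
by elim: i => [|i IH]; rewrite ?expr0 // !exprS fM IH.
Qed.

Lemma morph_hexp x : f (hexp x) = hexp (f x).
Proof.
rewrite !hexpE (hseries_linear _ (tsComplete A) (tsComplete B) lf).
by apply: eq_hseries => i; apply: morph_exp_term.
Qed.

Lemma morph_hexpm1 x : f (hexpm1 x) = hexpm1 (f x).
Proof.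
rewrite /hexpm1 (hseries_linear _ (tsComplete A) (tsComplete B) lf).
by apply: eq_hseries => i; apply: morph_exp_term.
Qed.

Lemma morph_hexpm1B s x y :
  f (s *: (hexpm1 x - hexpm1 y)) = s *: (hexpm1 (f x) - hexpm1 (f y)).
Proof. by rewrite (linear_scale lf) (linear_sub lf) !morph_hexpm1. Qed.
End ExpMorphism.

Lemma rinvE (A : pzRingType) (x y : A) : x * y = 1 -> y * x = 1 -> rinv x = y.
Proof.
move=> xy yx; rewrite /rinv /choose_with; case: pselect => [e|[]]; last by exists y.
by case: cid => z [xz zx] /=; rewrite -[z]mul1r -yx -mulrA xz mulr1.
Qed.

Section ScalarExp.
Variable K : fieldType.
Local Notation R := (hser K).
Hypothesis charK : [pchar K] =i pred0.
Implicit Types (r s : R).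

Lemma hexp_alg (A : topSuperAlg K) r : hexp (r *: (1 : A)) = scalar_exp r *: (1 : A).
Proof.
rewrite -(morph_hexp (f := fun r : baseTSA K => r *: (1 : A))) ?scale1r //.
  exact: scale_linear.
by move=> a b; rewrite -uaAl mul1r scalerA.
Qed.

Lemma hexp_shift (A : topSuperAlg K) r (x : A) :
  hexp (x + r *: (1 : A)) = scalar_exp r *: hexp x.
Proof.
rewrite hexpD // ?hexp_alg -?uaAr ?mulr1 //.
by rewrite /GRing.comm -uaAr -uaAl mulr1 mul1r.
Qed.

Lemma scalar_expD r s : scalar_exp (r + s) = scalar_exp r * scalar_exp s.
Proof. exact: (@hexpD K (baseTSA K) charK r s (mulrC r s)). Qed.

Lemma scalar_exp0 : scalar_exp (0 : R) = 1.
Proof. exact: (hexp0 (baseTSA K)). Qed.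

Lemma scalar_expN r : scalar_exp r * scalar_exp (- r) = 1.
Proof. by rewrite -scalar_expD subrr scalar_exp0. Qed.

Lemma rinv_scalar_exp r : rinv (scalar_exp r) = scalar_exp (- r).
Proof. by apply: rinvE; [|rewrite mulrC]; apply: scalar_expN. Qed.

Lemma scalar_exp_sum (I : finType) (F : I -> R) :
  scalar_exp (\sum_i F i) = \prod_i scalar_exp (F i).
Proof. exact: (big_morph _ scalar_expD scalar_exp0). Qed.

Lemma scalar_exp_nat r k : scalar_exp (r *+ k) = scalar_exp r ^+ k.
Proof.
by elim: k => [|k IH]; rewrite ?scalar_exp0 // mulrS exprS scalar_expD IH.
Qed.

(** After removing the constant term, the inverse is a geometric series. *)
Lemma hser_unit r : hcoef r 0%N != 0 -> exists s, r * s = 1.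
Proof.
move=> r0; set c := hcoef r 0%N.
pose y : R := Hser (fun m => - (c^-1 * hcoef r m.+1)).
have rE : r = hcst c * (1 - hbar * y).
  apply: hserP => m; rewrite hcoefM big_ord_recl subn0 big1 ?addr0 => [|i _]; last first.
    by rewrite mul0r.
  rewrite hcoefB -[hbar]expr1 hcoef_hbarXM.
  by case: m => [|m] /=; rewrite ?subr0 ?mulr1 // sub0r opprK subSS subn0 mulVKf.
pose g : baseTSA K := hseries (fun i => (y ^+ i : baseTSA K)).
have gE : g = 1 + hbar * (y * g) :> R.
  have cR := tsComplete (baseTSA K).
  apply: etrans (hseries_recl cR (fun i => (y ^+ i : baseTSA K))) _.
  congr (1 + hbar * _ : R); apply: esym.
  apply: etrans (hseries_linear _ cR cR (lmul_linear (y : baseTSA K))) _.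
  by apply: eq_hseries => i; rewrite exprS.
exists (hcst c^-1 * g); rewrite rE mulrACA -hcstM mulfV // hcst1 mul1r.
by rewrite mulrBl mul1r -mulrA {1}gE addrK.
Qed.

(** The constant term of the unit is [2 c]. *)
Lemma scalar_exp_sinh (c : K) : c != 0 ->
  exists u s : R, scalar_exp (hcst c) - rinv (scalar_exp (hcst c)) = hbar * u
    /\ u * s = 1.
Proof.
move=> c0; have [e expE e0] : exists2 e : R -> R,
    forall r, scalar_exp r = 1 + hbar * e r & forall r, hcoef (e r) 0%N = hcoef r 0%N.
  exists (fun r => hexpm1 (r : baseTSA K)) => r; first exact: (@hexp_hexpm1 K (baseTSA K)).
  rewrite /hexpm1 (hseries_recl (tsComplete (baseTSA K))).
  rewrite /exp_term expr1 invr1 hcst1 scale1r hcoefD.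
  rewrite -[X in _ + hcoef X _]/(hbar * _) -[hbar]expr1 hcoef_hbarXM ltn0Sn.
  by rewrite addr0.
exists (e (hcst c) - e (- hcst c)).
have [|s us] := @hser_unit (e (hcst c) - e (- hcst c)).
  rewrite hcoefB !e0 /= opprK -mulr2n -mulr_natl mulf_neq0 //.
  by have /pcharf0P -> := charK.
exists s; split=> //; rewrite rinv_scalar_exp !expE mulrBr opprD addrACA subrr.
by rewrite add0r.
Qed.

Lemma hbar_inj (B : nzRingType) : injective (fun x : hser B => hbar * x).
Proof.
move=> x y xy; apply: hserP => m.
have coef_hbarM (z : hser B) : hcoef (hbar * z) m.+1 = hcoef z m.
  by rewrite -[hbar]expr1 hcoef_hbarXM /= subSS subn0.
by rewrite -!coef_hbarM; congr (hcoef _ _).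
Qed.
End ScalarExp.

Lemma ratr_neq0 (K : fieldType) (c : rat) :
  [pchar K] =i pred0 -> c != 0 -> ratr c != 0 :> K.
Proof.
move=> /pcharf0P charK c0.
have nz (m : int) : m != 0 -> m%:~R != 0 :> K.
  case: m => k k0; first by rewrite /= -pmulrn charK.
  by rewrite NegzE mulrNz oppr_eq0 -pmulrn charK.
by rewrite /ratr mulf_neq0 ?nz ?numq_eq0 // invr_neq0 // nz.
Qed.

(* From here on scalar exponentials enter only through their functional equation. *)
#[local] Opaque scalar_exp.

(** * Universal property of generators and relations *)

Section SeriesSuperAlg.
Variables (K : fieldType) (M : lalgType K) (part : bool -> M -> M).
Hypothesis M_central : forall (c : K) (g : M), c%:A * g = g * c%:A.
Hypothesis part_linear : forall s, linear (part s).
Hypothesis part_part : forall s t g,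
  part s (part t g) = if s == t then part t g else 0.
Hypothesis part_sum : forall g, part false g + part true g = g.
Hypothesis part_one : part false 1 = 1.
Hypothesis part_mul : forall s t g h,
  part (s (+) t) (part s g * part t h) = part s g * part t h.
Local Notation R := (hser K).
Local Notation MM := (seriesTSA M_central part_linear part_part part_sum
  part_one part_mul).

Lemma series_scaleE (r : R) (x : MM) :
  r *: x = hmap (GRing.in_alg M) r * (x : hser M) :> hser M.
Proof. by []. Qed.

Lemma hcoef_seriesZ (r : R) (x : MM) m :
  hcoef (r *: x) m = \sum_(i < m.+1) hcoef r i *: hcoef x (m - i)%N.
Proof.
by rewrite series_scaleE hcoefM; apply: eq_bigr => i _; rewrite /= mulr_algl.
Qed.

Lemma series_hcstZ (c : K) (g : M) :
  hcst (c *: g) = (hcst c : R) *: ((hcst g : hser M) : MM) :> hser M.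
Proof.
rewrite series_scaleE.
have -> : hmap (GRing.in_alg M) (hcst c) = hcst c%:A.
  by apply: hserP => -[|k] //=; rewrite scale0r.
by rewrite -hcstM mulr_algl.
Qed.

Lemma series_coefs (x : MM) :
  x = hseries (fun i => (hcst (hcoef x i) : hser M) : MM).
Proof.
apply: esym; apply: (hseries_eq (tsComplete MM)) => N.
have [y yE] := hsumE (fun i => hcst (hcoef (x : hser M) i)) N.
have hX k (z : hser M) : (hbar ^+ k : R) *: (z : MM) = hbar ^+ k * z :> hser M.
  by rewrite series_scaleE hmapX hmap_hbar.
exists y; rewrite hX -yE; congr (_ - _).
  apply: hserP => m /=; rewrite big_ord_recr /= subnn big1 ?add0r //= => i _.
  by case: (m - i)%N (subn_gt0 i m) => //; rewrite ltn_ord.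
by apply: eq_bigr => i _; rewrite hX.
Qed.

Lemma series_hbar_inj : injective (fun x : MM => (hbar : R) *: x).
Proof. by move=> x y; rewrite /= !series_scaleE hmap_hbar => /hbar_inj. Qed.
End SeriesSuperAlg.

Section MonoidAlgebra.
Variables (K : fieldType) (X : choiceType).
Local Notation M := {malg K[{fmonom X}]}.

Lemma malgU_scale (c : K) (w : {fmonom X}) : << c *g w >> = c *: << w >> :> M.
Proof.
apply/malgP => u; rewrite mcoeffU (mcoeffZ c (<< w >> : M) u) mcoeffU.
by rewrite mulrnAr mulr1.
Qed.

Lemma malgU_cons i (s : seq X) :
  << FMonom (i :: s) >> = << fmu i >> * << FMonom s >> :> M.
Proof.
apply: esym; apply: etrans (fgmulUU 1 1 (fmu i) (FMonom s)) _.
by rewrite mulr1; congr << _ >>; rewrite fmuE [LHS]fmmulE.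
Qed.
End MonoidAlgebra.

Section FreeEvaluation.
Variables (K : fieldType) (X : choiceType) (p : X -> bool).
Variables (A : topSuperAlg K) (v : X -> A).
Local Notation R := (hser K).
Local Notation M := {malg K[{fmonom X}]}.
Local Notation Free := (cfree K p).
Local Notation cA := (tsComplete A).
Implicit Types (g : M) (w : {fmonom X}) (x y : Free).

Definition word_eval w : A := \prod_(i <- (w : seq X)) v i.

Definition poly_eval g : A :=
  \sum_(w <- msupp g) (hcst g@_w : R) *: word_eval w.

Definition free_eval x : A := hseries (fun i => poly_eval (hcoef x i)).

Lemma poly_evalEw (d : {fset {fmonom X}}) g : (msupp g `<=` d)%fset ->
  poly_eval g = \sum_(w <- d) (hcst g@_w : R) *: word_eval w.
Proof.
move=> le; rewrite [LHS](big_fset_incl _ le) => //= w wd /mcoeff_outdom ->.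
by rewrite hcst0 scale0r.
Qed.

Lemma poly_evalD : {morph poly_eval : g h / g + h}.
Proof.
move=> g h; set d := (msupp g `|` msupp h)%fset.
rewrite (poly_evalEw (msuppD_le g h)) (poly_evalEw (fsubsetUl _ (msupp h))).
rewrite (poly_evalEw (fsubsetUr (msupp g) _)) -big_split.
by apply: eq_bigr => w _; rewrite mcoeffD hcstD scalerDl.
Qed.

Lemma poly_eval0 : poly_eval 0 = 0.
Proof. by apply: (addrI (poly_eval 0)); rewrite -poly_evalD !addr0. Qed.

Lemma poly_evalZ c g : poly_eval (c *: g) = (hcst c : R) *: poly_eval g.
Proof.
rewrite (poly_evalEw (msuppZ_le c g)) scaler_sumr.
by apply: eq_bigr => w _; rewrite mcoeffZ hcstM scalerA.
Qed.

Lemma poly_eval_sum (I : Type) (r : seq I) (Q : pred I) (F : I -> M) :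
  poly_eval (\sum_(i <- r | Q i) F i) = \sum_(i <- r | Q i) poly_eval (F i).
Proof. exact: (big_morph _ poly_evalD poly_eval0). Qed.

Lemma poly_evalU c w : poly_eval << c *g w >> = (hcst c : R) *: word_eval w.
Proof. by rewrite (poly_evalEw msuppU_le) big_seq_fset1 mcoeffUU. Qed.

Lemma poly_eval1 : poly_eval 1 = 1.
Proof.
rewrite [X in poly_eval X](_ : _ = << (1 : K) *g (mone : {fmonom X}) >>) //.
by rewrite poly_evalU hcst1 scale1r /word_eval fm1 big_nil.
Qed.

Lemma poly_evalM : {morph poly_eval : g h / g * h}.
Proof.
move=> g h; rewrite malgME poly_eval_sum mulr_suml; apply: eq_bigr => w _.
rewrite poly_eval_sum mulr_sumr; apply: eq_bigr => z _.
rewrite poly_evalU hcstM -scalerA /word_eval fmM big_cat /=.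
by rewrite -uaAl -uaAr.
Qed.

Lemma free_evalD : {morph free_eval : x y / x + y}.
Proof.
move=> x y; rewrite -(hseriesD cA).
by apply: eq_hseries => i; rewrite -poly_evalD.
Qed.

Lemma hcoef_cfreeZ (r : R) x m :
  hcoef (r *: x) m = \sum_(i < m.+1) hcoef r i *: hcoef x (m - i)%N.
Proof. exact: hcoef_seriesZ. Qed.

Lemma free_evalZ (r : R) x : free_eval (r *: x) = r *: free_eval x.
Proof.
rewrite (hseriesZ cA); apply: eq_hseries => m.
rewrite hcoef_cfreeZ poly_eval_sum.
by apply: eq_bigr => i _; rewrite poly_evalZ.
Qed.

Lemma free_eval_linear : linear free_eval.
Proof. by move=> r x y; rewrite free_evalD free_evalZ. Qed.

Lemma free_evalM : {morph free_eval : x y / x * y}.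
Proof.
move=> x y; rewrite hseriesM; apply: eq_hseries => m.
transitivity (poly_eval (hcoef ((x : hser M) * (y : hser M)) m)) => //.
by rewrite hcoefM poly_eval_sum; apply: eq_bigr => i _; rewrite poly_evalM.
Qed.

Lemma free_eval_cst g : free_eval (hcst g : hser M) = poly_eval g.
Proof.
rewrite /free_eval (hseries_recl cA) (hseries_eq cA (y := 0)) ?scaler0 ?addr0 //.
move=> N; rewrite big1 ?subrr; first exact: hdiv0.
by move=> i _; rewrite poly_eval0 scaler0.
Qed.

Lemma free_eval1 : free_eval 1 = 1.
Proof. by rewrite -[RHS]poly_eval1 -free_eval_cst. Qed.

Lemma free_eval_cvar i : free_eval (cvar K p i) = v i.
Proof.
by rewrite free_eval_cst poly_evalU hcst1 scale1r /word_eval fmU big_seq1.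
Qed.

Lemma cfree_coefs x : x = hseries (fun i => (hcst (hcoef x i) : hser M) : Free).
Proof. exact: series_coefs. Qed.

Lemma cfree_hbar_inj : injective (fun x : Free => (hbar : R) *: x).
Proof. exact: series_hbar_inj. Qed.

(** The uniqueness half of the universal property: a linear map commutes with
    convergent series, and each coefficient is a combination of words. *)
Lemma free_eval_unique (f : Free -> A) :
    linear f -> f 1 = 1 -> {morph f : x y / x * y} ->
    (forall i, f (cvar K p i) = v i) ->
  f =1 free_eval.
Proof.
move=> lf f1 fM fv x; rewrite {1}[x]cfree_coefs.
rewrite (hseries_linear _ (tsComplete Free) cA lf).
apply: eq_hseries => m; move: (hcoef x m) => g.
have fcD : {morph (fun g => f (hcst g : hser M)) : g h / g + h}.
  by move=> g1 g2; rewrite hcstD (linear_add lf).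
have fc0 : f (hcst 0 : hser M) = 0.
  by rewrite hcst0 (linear_zero lf).
rewrite {1}[g]monalgE [LHS](big_morph _ fcD fc0); apply: eq_bigr => w _.
have -> : hcst << g@_w *g w >> = (hcst g@_w : R) *: ((hcst << w >> : hser M) : Free).
  transitivity (hcst (g@_w *: << w >>) : hser M); last exact: series_hcstZ.
  by congr (hcst _); apply: malgU_scale.
rewrite (linear_scale lf); congr (_ *: _).
case: w => s; elim: s => [|i s IH].
  by rewrite /word_eval big_nil -[RHS]f1 -fmoneE.
have -> : hcst << FMonom (i :: s) >>
    = (cvar K p i : Free) * ((hcst << FMonom s >> : hser M) : Free).
  by rewrite malgU_cons hcstM.
by rewrite fM fv IH /word_eval big_cons.
Qed.

Hypothesis v_homog : forall i, spart (p i) (v i) = v i.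

Lemma word_eval_homog w : spart (wpar p w) (word_eval w) = word_eval w.
Proof.
rewrite /wpar /word_eval; case: w => s /=; elim: s => [|i s IH].
  by rewrite big_nil spart_one.
by rewrite big_cons /= oddD oddb -{1}IH -{1}v_homog spart_mul IH v_homog.
Qed.

Lemma free_eval_spart s x : free_eval (spart s x) = spart s (free_eval x).
Proof.
rewrite spart_hseries; apply: eq_hseries => m.
transitivity (poly_eval (mpart p s (hcoef x m))) => //.
move: (hcoef x m) => g.
rewrite poly_eval_sum [in RHS]/poly_eval (linear_bigsum (spart_linear s)) big_mkcond /=.
apply: eq_bigr => w _; rewrite (linear_scale (spart_linear s)).
rewrite -[word_eval w in RHS]word_eval_homog spart_spart word_eval_homog.
by rewrite [s == _]eq_sym; case: ifP => _; rewrite ?scaler0 ?poly_evalU.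
Qed.

Lemma free_eval_morph : is_salg_morph free_eval.
Proof.
split; [exact: free_eval_linear | exact: free_eval1 | exact: free_evalM |].
exact: free_eval_spart.
Qed.
End FreeEvaluation.

Lemma id_salg_morph (K : fieldType) (A : topSuperAlg K) :
  is_salg_morph (fun x : A => x).
Proof. by split. Qed.

Lemma comp_salg_morph (K : fieldType) (A B C : topSuperAlg K) (f : B -> C) (g : A -> B) :
  is_salg_morph f -> is_salg_morph g -> is_salg_morph (fun x => f (g x)).
Proof.
move=> [lf f1 fM fs] [lg g1 gM gs].
split=> [r x y||x y|s x]; first by rewrite lg lf.
- by rewrite g1.
- by rewrite gM.
- by rewrite gs fs.
Qed.

(** Closedness of the kernel comes from the separatedness of [B]. *)
Lemma kernel_closed_ideal (K : fieldType) (A B : topSuperAlg K) (f : A -> B) :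
  is_salg_morph f -> closed_ideal (fun x => f x = 0).
Proof.
case=> lf f1 fM fs; split.
- exact: linear_zero.
- by move=> x y fx fy; rewrite (linear_add lf) fx fy addr0.
- by move=> a x fx; rewrite fM fx mulr0.
- by move=> x a fx; rewrite fM fx mul0r.
- by move=> s x fx; rewrite fs fx spart0.
move=> x xN; apply: (hdiv_eq (tsComplete B)) => N; have [y fy xy] := xN N.
by rewrite -fy -(linear_sub lf); apply: hdiv_linear.
Qed.

Lemma cvar_homog (K : fieldType) (X : choiceType) (p : X -> bool) i :
  spart (p i) (cvar K p i) = cvar K p i.
Proof.
apply: hserP => -[|m]; last exact: (part0 (@mpart_linear K X p)).
apply: etrans (_ : mpart p (p i) << fmu i >> = << fmu i >>) => //.
apply/malgP => w; rewrite mcoeff_mpart mcoeffU.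
case: (fmu i =P w) => [<-|_]; last by rewrite mulr0n if_same.
by rewrite /wpar fmU /= addn0 oddb eqxx.
Qed.

Section PresentedLift.
Variables (K : fieldType) (X : choiceType) (p : X -> bool).
Variables (rel : cfree K p -> Prop) (A : topSuperAlg K).

Lemma qproj_morph : is_salg_morph (qproj rel : cfree K p -> presented rel).
Proof.
split; first by move=> r x y; rewrite qprojD qprojZ.
- exact: qproj1.
- exact: qprojM.
- by move=> s x; rewrite -quot_partE.
Qed.

Lemma qproj_rel r : rel r -> qproj rel r = 0.
Proof.
by move=> rr; rewrite -[RHS](qproj0 rel); apply/qprojP => I _; rewrite subr0; apply.
Qed.

Lemma pgen_homog i : spart (p i) (pgen rel i) = pgen rel i.
Proof. by apply: etrans (quot_partE rel _ _) _; rewrite cvar_homog. Qed.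

Lemma presented_lift (v : X -> A) :
    (forall i, spart (p i) (v i) = v i) ->
    (forall r, rel r -> free_eval v r = 0) ->
  exists2 f : presented rel -> A, is_salg_morph f &
    forall i, f (pgen rel i) = v i.
Proof.
move=> v_homog v_rel; have fe := free_eval_morph v_homog.
case: (fe) => lf f1 fM fs.
pose f (x : presented rel) : A := free_eval v (qrepr x).
have fE x : f (qproj rel x) = free_eval v x.
  apply/eqP; rewrite -subr_eq0 -(linear_sub lf); apply/eqP.
  exact: (qrepr_pi x (kernel_closed_ideal fe) v_rel).
exists f => [|i]; last by rewrite fE free_eval_cvar.
split=> [r x y||x y|s x].
- by elim/qproj_ind: x => x; elim/qproj_ind: y => y; rewrite -qprojZ -qprojD !fE lf.
- by rewrite -(qproj1 rel) fE.
- by elim/qproj_ind: x => x; elim/qproj_ind: y => y; rewrite -qprojM !fE fM.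
- elim/qproj_ind: x => x; apply: etrans (congr1 f (quot_partE rel s x)) _.
  by rewrite !fE fs.
Qed.

Lemma presented_ext (f g : presented rel -> A) :
    is_salg_morph f -> is_salg_morph g ->
    (forall i, f (pgen rel i) = g (pgen rel i)) ->
  f =1 g.
Proof.
have [lp p1 pM _] := qproj_morph.
move=> [lf f1 fM _] [lg g1 gM _] fg; elim/qproj_ind => x.
pose v i := g (pgen rel i).
have compE (k : presented rel -> A) : linear k -> k 1 = 1 ->
    {morph k : x y / x * y} -> (forall i, k (pgen rel i) = v i) ->
    forall y, k (qproj rel y) = free_eval v y.
  move=> lk k1 kM kv; apply: free_eval_unique => // [r y z|y z].
    by rewrite lp lk.
  by rewrite pM kM.
apply: etrans (compE f lf f1 fM fg x) (esym _).
exact: (compE g lg g1 gM (fun=> erefl) x).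
Qed.
End PresentedLift.

(** * Elements of given weight and their twists *)

Section WeightVectors.
Variables (K : fieldType) (charK : [pchar K] =i pred0).
Local Notation R := (hser K).
Variables (n : nat) (h : lmodType R) (A : topSuperAlg K).
Variables (alpha : 'I_n -> {scalar h}) (t : h -> A).
Hypotheses (t_linear : linear t) (t_comm : forall T T', t T * t T' = t T' * t T).
Variable Z : 'I_n -> h.
Hypothesis Z_anti : forall i j, alpha j (Z i) = - alpha i (Z j).
Implicit Types (T : h) (b c : 'I_n -> nat) (e : bool) (x y : A) (r s : R).

Definition expT T : A := hexp (t T).

Lemma expTD T T' : expT (T + T') = expT T * expT T'.
Proof. by rewrite /expT (linear_add t_linear); apply: hexpD => //; apply: t_comm. Qed.

Lemma expT0 : expT 0 = 1.
Proof. by rewrite /expT (linear_zero t_linear) hexp0. Qed.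

Definition weight e b T : R := (if e then 1 else -1) * \sum_i (b i)%:R * alpha i T.

Definition has_weight e b x := forall T, t T * x = x * t T + weight e b T *: x.

Lemma has_weight_expT e b x T : has_weight e b x ->
  x * expT T = scalar_exp (- weight e b T) *: (expT T * x).
Proof.
move=> wx; rewrite uaAl -hexp_shift //; apply: hexp_intertwine.
by rewrite mulrDl wx -uaAl mul1r scaleNr addrK.
Qed.

Lemma expT_mul e b x T T' y : has_weight e b x ->
  (expT T * x) * (expT T' * y)
  = scalar_exp (- weight e b T') *: (expT (T + T') * (x * y)).
Proof.
move=> wx; rewrite mulrA -[expT T * x * _]mulrA (has_weight_expT _ wx).
by rewrite -uaAr -uaAl expTD !mulrA.
Qed.

Lemma weightD e b c T :
  weight e (fun i => (b i + c i)%N) T = weight e b T + weight e c T.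
Proof.
rewrite /weight -mulrDr -big_split; congr (_ * _); apply: eq_bigr => i _ /=.
by rewrite natrD mulrDl.
Qed.

Lemma weight_delta e i T :
  weight e (fun l => (l == i)%N) T = (if e then 1 else -1) * alpha i T.
Proof.
rewrite /weight (bigD1 i) //= eqxx mul1r big1 ?addr0 // => j /negPf ->.
by rewrite mul0r.
Qed.

Lemma has_weightM e b c x y : has_weight e b x -> has_weight e c y ->
  has_weight e (fun i => (b i + c i)%N) (x * y).
Proof.
move=> wx wy T; rewrite mulrA wx mulrDl -mulrA wy mulrDr mulrA weightD.
by rewrite -uaAr -uaAl scalerDl -addrA [_ + weight e b T *: _]addrC.
Qed.

(** What a product of multidegree [b] picks up in the exponent when every
    generator of degree [i] is multiplied by [expT (Z i)]. *)
Definition shift b : h := \sum_i (b i)%:R *: Z i.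

Lemma shiftD b c : shift (fun i => (b i + c i)%N) = shift b + shift c.
Proof.
rewrite /shift -big_split; apply: eq_bigr => i _ /=.
by rewrite natrD scalerDl.
Qed.

Lemma shift_delta i : shift (fun l => (l == i)%N) = Z i.
Proof.
rewrite /shift (bigD1 i) //= eqxx scale1r big1 ?addr0 // => j /negPf ->.
by rewrite scale0r.
Qed.

(** The exponent of the scalar that appears when [expT (shift c)] is moved to the
    left of an element of degree [b]; it is alternating by [Z_anti]. *)
Definition cform e b c : R := weight e c (shift b).

Lemma cformDl e b b' c :
  cform e (fun i => (b i + b' i)%N) c = cform e b c + cform e b' c.
Proof.
rewrite /cform shiftD /weight -mulrDr; congr (_ * _); rewrite -[RHS]big_split.
by apply: eq_bigr => i _ /=; rewrite linearD mulrDr.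
Qed.

Lemma cformE e b c : cform e b c
  = \sum_i \sum_j ((if e then 1 else -1) * alpha j (Z i)) *+ (b i * c j)%N.
Proof.
rewrite /cform /weight exchange_big mulr_sumr; apply: eq_bigr => j _.
rewrite linear_sum !mulr_sumr; apply: eq_bigr => i _.
rewrite linearZ /= -[RHS]mulr_natr natrM; ring.
Qed.

Lemma cform_anti e b c : cform e c b = - cform e b c.
Proof.
rewrite !cformE -sumrN exchange_big; apply: eq_bigr => i _.
rewrite -sumrN; apply: eq_bigr => j _.
by rewrite Z_anti mulrN mulNrn mulnC.
Qed.

Lemma cformDr e b c c' :
  cform e b (fun i => (c i + c' i)%N) = cform e b c + cform e b c'.
Proof. by rewrite (cform_anti e _ b) cformDl opprD -!(cform_anti e _ b). Qed.

Lemma cform_delta e i j : cform e (fun l => (l == i)%N) (fun l => (l == j)%N)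
  = (if e then 1 else -1) * alpha j (Z i).
Proof. by rewrite /cform weight_delta shift_delta. Qed.

Lemma alpha_Z_diag i : alpha i (Z i) = 0.
Proof.
have /eqP := Z_anti i i; rewrite -addr_eq0 -mulr2n -mulr_natl => /eqP aii.
have h2 : (hcst 2^-1 : R) * 2%:R = 1.
  rewrite -hcst_nat -hcstM mulVf //.
  by have /pcharf0P -> := charK.
by rewrite -[LHS]mul1r -h2 -mulrA aii mulr0.
Qed.

(** [x'] is what becomes of [x], an expression of multidegree [b], when its
    generators are twisted; [s] records the scalar produced by collecting the
    exponentials on the left. *)
Definition twists e b s x' x : Prop :=
  has_weight e b x /\ x' = scalar_exp s *: (expT (shift b) * x).

Lemma twists_weight e b s x' x : twists e b s x' x -> has_weight e b x'.
Proof.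
move=> [wx ->] T; have cT : t T * expT (shift b) = expT (shift b) * t T.
  by apply: hexp_intertwine; apply: t_comm.
rewrite -uaAr -uaAl [_ *: (_ *: _)]scalerA [weight e b T * _]mulrC -scalerA.
by rewrite -scalerDr mulrA cT -mulrA wx mulrDr mulrA -uaAr.
Qed.

Lemma twists1 e : twists e (fun=> 0%N) 0 1 1.
Proof.
split=> [T|].
  by rewrite /weight big1 ?mulr0 ?scale0r ?addr0 ?mul1r ?mulr1 // => i _; rewrite mul0r.
rewrite /shift big1 => [|i _]; last by rewrite scale0r.
by rewrite expT0 mulr1 scalar_exp0 scale1r.
Qed.

(** Moving the twist of [y] across [x] costs a scalar, antisymmetric in the two
    degrees. *)
Lemma twistsM e b c s r x' x y' y :
  twists e b s x' x -> twists e c r y' y ->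
  twists e (fun i => (b i + c i)%N) (s + r + cform e b c) (x' * y') (x * y).
Proof.
move=> [wx ->] [wy ->]; split; first exact: has_weightM.
rewrite scaleM (expT_mul _ _ _ wx) scalerA.
rewrite -!(scalar_expD charK) -[weight _ _ _]/(cform e c b) cform_anti opprK.
by rewrite shiftD.
Qed.

Lemma twistsD e b s x' x y' y : twists e b s x' x -> twists e b s y' y ->
  twists e b s (x' + y') (x + y).
Proof.
move=> [wx ->] [wy ->]; split=> [T|]; last by rewrite mulrDr scalerDr.
by rewrite mulrDr wx wy mulrDl scalerDr addrACA.
Qed.

Lemma twists0 e b s : twists e b s 0 0.
Proof. by split=> [T|]; rewrite !(mulr0, mul0r, scaler0) ?addr0. Qed.

Lemma twistsZ e b s r k k' x' x :
    k' = k * scalar_exp r -> twists e b s x' x ->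
  twists e b (s + r) (k' *: x') (k *: x).
Proof.
move=> -> [wx ->]; split=> [T|].
  by rewrite -uaAr wx -uaAl scalerDr !scalerA mulrC.
rewrite -uaAr !scalerA (scalar_expD charK); congr (_ *: _).
by move: (scalar_exp r) (scalar_exp s) => a c; rewrite -mulrA mulrC (mulrC a c).
Qed.

Lemma twists_eq e b b' s s' x' x :
  b =1 b' -> s = s' -> twists e b s x' x -> twists e b' s' x' x.
Proof. by move=> /funext -> ->. Qed.

(** A factor [scalar_exp (cform e b c *+ 2)] on the second term of a bracket is
    exactly what makes both terms carry the same scalar. *)
Lemma twists_bracket e b c s r k k' x' x y' y :
    k' = k * scalar_exp (cform e b c *+ 2) ->
    twists e b s x' x -> twists e c r y' y ->
  twists e (fun i => (b i + c i)%N) (s + r + cform e b c)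
    (x' * y' - k' *: (y' * x')) (x * y - k *: (y * x)).
Proof.
move=> k'E tx ty; rewrite -!scaleNr; apply: twistsD; first exact: twistsM.
have k'NE : - k' = - k * scalar_exp (cform e b c *+ 2) by rewrite mulNr -k'E.
apply: (twists_eq _ _ (twistsZ k'NE (twistsM ty tx))).
  by move=> i; rewrite addnC.
rewrite (cform_anti e b c) [r + s]addrC mulr2n.
by move: (s + r) (cform e b c) => u v; rewrite addrA subrK.
Qed.

Lemma twists_sum e b s m (F' F : 'I_m -> A) :
  (forall i, twists e b s (F' i) (F i)) ->
  twists e b s (\sum_i F' i) (\sum_i F i).
Proof.
move=> tF; elim/big_rec2: _ => [|i y x _]; first exact: twists0.
exact: twistsD.
Qed.

Lemma twists_eq0 e b s x' : twists e b s x' 0 -> x' = 0.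
Proof. by case=> _ ->; rewrite mulr0 scaler0. Qed.

Lemma twistsX e b x' x m : twists e b 0 x' x -> cform e b b = 0 ->
  twists e (fun i => (m * b i)%N) 0 (x' ^+ m) (x ^+ m).
Proof.
move=> tx b0.
suff [] : twists e (fun i => (m * b i)%N) 0 (x' ^+ m) (x ^+ m)
    /\ cform e b (fun i => (m * b i)%N) = 0 by [].
elim: m => [|m [IH IH0]].
  split; first exact: twists_eq (twists1 e).
  by rewrite cformE big1 // => i _; rewrite big1 // => j _; rewrite muln0.
have mS : (fun i => (m.+1 * b i)%N) = (fun i => (b i + m * b i)%N).
  by apply/funext => i; rewrite mulSn.
rewrite !exprS mS; split; last by rewrite cformDr b0 IH0 addr0.
by apply: twists_eq (twistsM tx IH) => //; rewrite IH0 !addr0.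
Qed.
End WeightVectors.

(** * The twisted generators satisfy the twisted relations *)

Lemma bracket_morph (K : fieldType) (A B : topSuperAlg K) (f : A -> B)
    (k : hser K) (x y : A) :
    linear f -> {morph f : x y / x * y} ->
  f (x * y - k *: (y * x)) = f x * f y - k *: (f y * f x).
Proof. by move=> lf fM; rewrite (linear_sub lf) (linear_scale lf) !fM. Qed.

Lemma bracket_sub_morph (K : fieldType) (A B : topSuperAlg K) (f : A -> B)
    (k l : hser K) (x y w : A) :
    linear f -> {morph f : x y / x * y} ->
  f (x * y - k *: (y * x) - l *: w)
  = f x * f y - k *: (f y * f x) - l *: f w.
Proof.
by move=> lf fM; rewrite (linear_sub lf) (linear_scale lf) bracket_morph.
Qed.

Lemma commutator_morph (K : fieldType) (A B : topSuperAlg K) (f : A -> B) (x y : A) :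
    linear f -> {morph f : x y / x * y} ->
  f (x * y - y * x) = f x * f y - f y * f x.
Proof. by move=> lf fM; rewrite (linear_sub lf) !fM. Qed.

Lemma serre_morph (K : fieldType) (A B : topSuperAlg K) (f : A -> B) m
    (c : 'I_m -> hser K) (k l : 'I_m -> nat) (x y : A) :
    linear f -> f 1 = 1 -> {morph f : x y / x * y} ->
  f (\sum_i c i *: (x ^+ k i * y * x ^+ l i))
  = \sum_i c i *: (f x ^+ k i * f y * f x ^+ l i).
Proof.
move=> lf f1 fM; rewrite (linear_bigsum lf); apply: eq_bigr => i _.
have fX j : f (x ^+ j) = f x ^+ j.
  by elim: j => [|j IH]; rewrite ?expr0 // !exprS fM IH.
by rewrite (linear_scale lf) !fM !fX.
Qed.

(** The data of a presentation before and after a toral twist: [Z i] is the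
    element whose exponential multiplies [E_i] and [F_i], and its values
    [alpha_j (Z i)] form an antisymmetric matrix.  Stated for arbitrary matrices,
    this is a relation that can be reversed by changing the sign of [Z], so that
    the inverse of a twist is again a twist. *)
Record toral_pair (K : fieldType) n (h : lmodType (hser K)) (Z : 'I_n -> h)
    (P P' : 'M[hser K]_n) (rz rz' : realization n h) : Prop := ToralPair {
  pair_rTp : forall i, rTp rz' i = rTp rz i + (Z i + Z i);
  pair_rTm : forall i, rTm rz' i = rTm rz i - (Z i + Z i);
  pair_rAlpha : forall i T, rAlpha rz' i T = rAlpha rz i T;
  pair_P : forall i j, hcst 2^-1 * (P' i j - P' j i)
     = hcst 2^-1 * (P i j - P j i) + rAlpha rz j (Z i) *+ 2;
  pair_anti : forall i j, rAlpha rz j (Z i) = - rAlpha rz i (Z j)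
}.

Lemma toral_pair_sym (K : fieldType) n (h : lmodType (hser K)) (Z : 'I_n -> h)
    (P P' : 'M[hser K]_n) (rz rz' : realization n h) :
  toral_pair Z P P' rz rz' -> toral_pair (fun i => - Z i) P' P rz' rz.
Proof.
case=> eTp eTm ea eP anti; split=> [i|i|i T|i j|i j].
- by rewrite eTp -opprD addrK.
- by rewrite eTm -opprD opprK subrK.
- by rewrite ea.
- by rewrite ea eP linearN mulNrn addrK.
- by rewrite !ea !linearN anti.
Qed.

Section TwistedRelations.
Variables (K : fieldType) (charK : [pchar K] =i pred0).
Local Notation R := (hser K).
Variables (n : nat) (D : superDatum n) (d : 'I_n -> rat).
Hypothesis d_neq0 : forall i, d i != 0.
Variables (h : lmodType R) (P P' : 'M[R]_n) (rz rz' : realization n h).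
Variable Z : 'I_n -> h.
Hypothesis PZ : toral_pair Z P P' rz rz'.
Let rTp_twist := pair_rTp PZ.
Let rTm_twist := pair_rTm PZ.
Let rAlpha_twist := pair_rAlpha PZ.
Let P_twist := pair_P PZ.
Let Z_anti := pair_anti PZ.
Local Notation Free := (cfree K (fpar D (h := h))).
Local Notation T_ x := (cvar K (fpar D (h := h)) (gT n x)).
Local Notation XX := (X_ D h).
Variables (A : topSuperAlg K) (pi phi : Free -> A).
Hypotheses (pi_linear : linear pi) (pi1 : pi 1 = 1) (piM : {morph pi : x y / x * y}).
Hypothesis pi_rel : forall r, fomp_rel d P rz r -> pi r = 0.
Hypotheses (phi_linear : linear phi) (phi1 : phi 1 = 1)
  (phiM : {morph phi : x y / x * y}).
Hypotheses (phi_T : forall T, phi (T_ T) = pi (T_ T))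
  (phi_X : forall e i, phi (XX e i) = hexp (pi (T_ (Z i))) * pi (XX e i)).

Local Notation t := (fun T : h => pi (T_ T)).
Local Notation twists := (twists (rAlpha rz) t Z).
Local Notation cform := (cform (rAlpha rz) Z).
Local Notation delta i := (fun l => nat_of_bool (l == i)).

Lemma T_linear : linear t.
Proof.
move=> r T T'; apply/eqP; rewrite -subr_eq0 -(linear_scale pi_linear).
rewrite -(linear_add pi_linear) -(linear_sub pi_linear); apply/eqP.
by apply: pi_rel; apply: rel_lin.
Qed.

Lemma T_comm T T' : t T * t T' = t T' * t T.
Proof.
apply/eqP; rewrite -subr_eq0 -!piM -(linear_sub pi_linear); apply/eqP.
by apply: pi_rel; apply: rel_TT.
Qed.

Lemma X_weight e i : has_weight (rAlpha rz) t e (delta i) (pi (XX e i)).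
Proof.
move=> T; rewrite weight_delta; apply/eqP; rewrite -subr_eq0 opprD addrA.
rewrite -!piM -(linear_sub pi_linear) -(linear_scale pi_linear).
rewrite -(linear_sub pi_linear); apply/eqP; apply: pi_rel.
case: e; rewrite ?mul1r ?mulN1r ?scaleNr ?opprK.
  exact: rel_TE.
exact: rel_TF.
Qed.

Lemma X_twists e i : twists e (delta i) 0 (phi (XX e i)) (pi (XX e i)).
Proof.
split; first exact: X_weight.
by rewrite phi_X (shift_delta Z i) scalar_exp0 scale1r.
Qed.

Definition welt_twists e s (x' x : welt D h) : Prop :=
  x'.2 = x.2 /\ twists e x.2 s (phi x'.1) (pi x.1).

Lemma wX_twists e i : welt_twists e 0 (wX D h e i) (wX D h e i).
Proof. by split=> //; apply: X_twists. Qed.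

Lemma kX_twist e i j :
  kX P' e i j = kX P e i j * scalar_exp (cform e (delta i) (delta j) *+ 2).
Proof.
rewrite cform_delta /kX /k_; case: e; last first.
  by rewrite (P_twist j i) (scalar_expD charK) Z_anti mulN1r.
by rewrite (P_twist i j) (scalar_expD charK) mul1r.
Qed.

Lemma kX_prod_twist e b c :
  \prod_i \prod_j kX P' e i j ^+ (b i * c j)%N
  = \prod_i \prod_j kX P e i j ^+ (b i * c j)%N * scalar_exp (cform e b c *+ 2).
Proof.
rewrite cformE -sumrMnl scalar_exp_sum // -big_split; apply: eq_bigr => i _ /=.
rewrite -sumrMnl scalar_exp_sum // -big_split; apply: eq_bigr => j _ /=.
rewrite kX_twist cform_delta; move: (b i * c j)%N => k.
by rewrite exprMn -(scalar_exp_nat charK) mulrnAC.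
Qed.

(** The step of the induction over iterated brackets; only the exponent of the
    overall scalar depends on the way in which they are nested. *)
Lemma br_twists e nu s r x' x y' y :
  welt_twists e s x' x -> welt_twists e r y' y ->
  welt_twists e (s + r + cform e x.2 y.2) (br P' e nu x' y') (br P e nu x y).
Proof.
case: x' x y' y => [x' b'] [x b] [y' c'] [y c] [/= -> tx] [/= -> ty].
rewrite /welt_twists /br /welt_par; cbn [fst snd]; split; first exact: erefl.
rewrite (bracket_morph _ x' y' phi_linear phiM) (bracket_morph _ x y pi_linear piM).
apply: (twists_bracket charK T_linear T_comm Z_anti _ tx ty).
by apply: etrans (congr1 _ (kX_prod_twist e b c)) _; apply: mulrA.
Qed.

Lemma phi_br_eq0 e s x' x : welt_twists e s x' x -> pi x.1 = 0 -> phi x'.1 = 0.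
Proof. by move=> [_ tx] x0; rewrite x0 in tx; apply: twists_eq0 tx. Qed.

(** Carrying [s] of the generators of index [i] to the right of the one of index
    [j] costs the scalar of exponent [- 2 s cform], which the factor [k ^ s]
    restores: all terms of a Serre sum have the same scalar. *)
Lemma serre_twists e i j m s r : (s <= m)%N ->
  twists e (fun l => (m * (l == i) + (l == j))%N) (cform e (delta i) (delta j) *+ m)
    ((r * kX P' e i j ^+ s) *: (phi (XX e i) ^+ (m - s) * phi (XX e j) * phi (XX e i) ^+ s))
    ((r * kX P e i j ^+ s) *: (pi (XX e i) ^+ (m - s) * pi (XX e j) * pi (XX e i) ^+ s)).
Proof.
move=> sm; have ii : cform e (delta i) (delta i) = 0.
  by rewrite cform_delta (alpha_Z_diag charK Z_anti) mulr0.
have tX k := twistsX charK T_linear T_comm Z_anti k (X_twists e i) ii.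
have cX k c : cform e (fun l => (k * (l == i))%N) c = cform e (delta i) c *+ k.
  rewrite !cformE -sumrMnl; apply: eq_bigr => l _; rewrite -sumrMnl.
  by apply: eq_bigr => l' _; rewrite -mulrnA; congr (_ *+ _); ring.
have := twistsM charK T_linear T_comm Z_anti
  (twistsM charK T_linear T_comm Z_anti (tX (m - s)%N) (X_twists e j)) (tX s).
have kE : r * kX P' e i j ^+ s
    = r * kX P e i j ^+ s * scalar_exp (cform e (delta i) (delta j) *+ 2 *+ s).
  rewrite (kX_twist e i j) exprMn -mulrA; congr (_ * (_ * _)); apply: esym.
  exact: scalar_exp_nat.
move=> /(twistsZ charK kE).
apply: twists_eq => [l|].
  by rewrite addnAC -mulnDl subnK.
have cXr k c : cform e c (fun l => (k * (l == i))%N) = - (cform e (delta i) c *+ k).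
  by rewrite (cform_anti Z_anti) cX.
rewrite cformDl !cXr !cX ii mul0rn oppr0 mul0rn oppr0 !add0r addr0.
move: (cform _ _ _) => c; rewrite -{2}(subnK sm) mulrnDr -addrA; congr (_ + _).
by rewrite mulr2n mulrnDl addKr.
Qed.

(** The quotient by [q_i - q_i^-1], in a form that every algebra homomorphism
    preserves.  The free algebra has no torsion, so [hbar] may be cancelled. *)
Lemma EF_quotient i : exists s : R, forall a b w : Free,
  (q_ K d i - rinv (q_ K d i)) *: w = hexp a - hexp b
  <-> w = s *: (hexpm1 a - hexpm1 b).
Proof.
have [u [s [qE us]]] := scalar_exp_sinh charK (ratr_neq0 charK (d_neq0 i)).
exists s => a b w; rewrite /q_ qE !hexp_hexpm1 opprD addrACA subrr add0r.
rewrite -scalerBr -scalerA; split=> [/cfree_hbar_inj <-|->].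
  by rewrite scalerA [s * u]mulrC us scale1r.
by rewrite [u *: _]scalerA us scale1r.
Qed.

(** For [i <> j] the right-hand side is zero before and after the twist.  For
    [i = j] the twist multiplies both sides by the exponential of [2 Z_i]; on the
    right this is [hexpm1B]. *)
Lemma phi_EF i j w :
    (q_ K d i - rinv (q_ K d i)) *: w
      = hexp (T_ (rTp rz' i)) - hexp (- T_ (rTm rz' i)) ->
  phi (XX true i * XX false j
       - ((-1) ^+ (sdPar D i && sdPar D j) : R) *: (XX false j * XX true i)
       - ((i == j)%:R : R) *: w) = 0.
Proof.
have [s sP] := EF_quotient i; move=> /sP ->.
set sg : R := (-1) ^+ _; set a := T_ _; set b := - T_ _.
pose a0 := T_ (rTp rz i); pose b0 := - T_ (rTm rz i).
pose w0 := s *: (hexpm1 a0 - hexpm1 b0).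
have rel0 : pi (XX true i * XX false j - sg *: (XX false j * XX true i)
    - ((i == j)%:R : R) *: w0) = 0.
  by apply: pi_rel; apply: rel_EF; apply/sP.
have phi_a : phi a = pi a0 + t (Z i + Z i).
  by rewrite phi_T rTp_twist (linear_add T_linear).
have phi_b : phi b = pi b0 + t (Z i + Z i).
  rewrite (linear_opp phi_linear) phi_T rTm_twist (linear_sub T_linear).
  by rewrite opprD opprK -(linear_opp pi_linear).
have comm_a0 : GRing.comm (pi a0) (t (Z i + Z i)) by exact: T_comm.
have comm_b0 : GRing.comm (pi b0) (t (Z i + Z i)).
  rewrite (linear_opp pi_linear); apply: commr_sym; apply: commrN; exact: T_comm.
have phi_w : phi (s *: (hexpm1 a - hexpm1 b)) = expT t (Z i + Z i) * pi w0.
  rewrite (morph_hexpm1B phi_linear phi1 phiM) (morph_hexpm1B pi_linear pi1 piM).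
  by rewrite phi_a phi_b hexpm1B // -uaAr.
have Zi0 : rAlpha rz i (Z i) = 0 := alpha_Z_diag charK Z_anti i.
apply: etrans (bracket_sub_morph _ _ _ _ _ phi_linear phiM) _.
move: rel0 => /(etrans (esym (bracket_sub_morph _ _ _ _ _ pi_linear piM))).
move=> /eqP; rewrite subr_eq0 => /eqP rel0.
rewrite phi_w (phi_X true i) (phi_X false j).
rewrite -![hexp (pi _)]/(expT t _).
rewrite (expT_mul charK T_linear T_comm _ _ _ (X_weight true i)).
rewrite (expT_mul charK T_linear T_comm _ _ _ (X_weight false j)).
rewrite !weight_delta mul1r mulN1r opprK -Z_anti [Z j + _]addrC.
rewrite scalerA [sg * _]mulrC -scalerA -scalerBr uaAr -mulrBr rel0.
case: eqP => [<-|_]; last by rewrite !scale0r mulr0 scaler0 subrr.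
by rewrite Zi0 scalar_exp0 !scale1r subrr.
Qed.

Lemma phi_serre e i j : i != j -> sdPar D i = false ->
  let m := `|1 - cartan D i j|%N in
  phi (\sum_(s < m.+1)
    ((-1) ^+ s * qbin (q_ K d i) m s * kX P' e i j ^+ s) *:
      (XX e i ^+ (m - s) * XX e j * XX e i ^+ s)) = 0.
Proof.
move=> ij pi0 m; have rel0 := pi_rel (rel_serre d P rz e ij pi0).
have := serre_morph _ _ _ (XX e i) (XX e j) phi_linear phi1 phiM.
move=> ->; move: rel0.
rewrite (serre_morph _ _ _ (XX e i) (XX e j) pi_linear pi1 piM) => rel0.
have := twists_sum (fun s : 'I_m.+1 => serre_twists e i j
  ((-1) ^+ s * qbin (q_ K d i) m s) (ltn_ord s : (s <= m)%N)).
by rewrite rel0 => /twists_eq0.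
Qed.

(** The two sides contain the generators [j] and [k] in opposite orders, hence
    differ by the scalar of exponent [2 cform] that the twist puts into the factor
    [kX e j k]. *)
Lemma phi_D2 e (i j k : 'I_n) :
    sdFam D = FamD2 -> i.+1 = j -> j.+1 = k -> k.+1 = n ->
  phi ((br P' e (nu_ K D k) (br P' e (nu_ K D j) (wX D h e i) (wX D h e j)) (wX D h e k)).1
    - kX P' e j k *:
      (br P' e (nu_ K D k) (br P' e (nu_ K D j) (wX D h e i) (wX D h e k)) (wX D h e j)).1)
  = 0.
Proof.
move=> famD ij jk kn; have := pi_rel (rel_D d P rz e famD ij jk kn).
rewrite (linear_sub pi_linear) (linear_scale pi_linear) => rel0.
rewrite (linear_sub phi_linear) (linear_scale phi_linear).
have tw a b c := br_twists (nu_ K D k) (br_twists (nu_ K D j)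
  (wX_twists e a) (wX_twists e b)) (wX_twists e c).
have [_ tijk] := tw i j k; have [_ tikj] := tw i k j.
apply: (twists_eq0 (b := fun l => ((l == i) + (l == j) + (l == k))%N) (e := e)).
rewrite -rel0 -!scaleNr; apply: twistsD tijk _.
have kE : - kX P' e j k
    = - kX P e j k * scalar_exp (cform e (delta j) (delta k) *+ 2).
  by rewrite mulNr -kX_twist.
apply: (twists_eq _ _ (twistsZ charK kE tikj)) => [l|]; first exact: addnAC.
rewrite !add0r !addr0 !cformDl (cform_anti Z_anti e (delta j) (delta k)).
rewrite /wX; cbn [snd]; move: (cform _ _ _) (cform _ _ _) (cform _ _ _) => u v w.
ring.
Qed.

Lemma phi_commutator_T e i T :
  phi (T_ T * XX e i - XX e i * T_ T)
  = ((if e then 1 else -1) * rAlpha rz' i T) *: phi (XX e i).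
Proof.
apply: etrans (commutator_morph _ _ phi_linear phiM) _.
rewrite phi_T rAlpha_twist -weight_delta.
by rewrite (twists_weight T_comm (X_twists e i) T) addrAC subrr add0r.
Qed.

Lemma twisted_relations r : fomp_rel d P' rz' r -> phi r = 0.
Proof.
case=> {r} [r T T'|T T'|T j|T j|i j w wE|e i j ij i0 m|e i j aij|e i j k cf
  |e i j fam ij jn|e i j k fam ij jk kn|e i j k fam ij jk kn gi gj Y
  |e l i j k fam li ij jk kn gi gj Y].
- rewrite (linear_sub phi_linear) (linear_add phi_linear) (linear_scale phi_linear).
  by rewrite !phi_T T_linear subrr.
- by rewrite (commutator_morph _ _ phi_linear phiM) !phi_T T_comm subrr.
- apply: etrans (linear_sub phi_linear _ _) _.
  by rewrite (phi_commutator_T true) (linear_scale phi_linear) mul1r subrr.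
- apply: etrans (linear_add phi_linear _ _) _.
  by rewrite (phi_commutator_T false) (linear_scale phi_linear) mulN1r scaleNr addNr.
- exact: phi_EF.
- exact: phi_serre.
- apply: (phi_br_eq0 (br_twists _ (wX_twists e i) (wX_twists e j))).
  by apply: pi_rel; apply: rel_zero.
- apply: (phi_br_eq0 (br_twists _ (br_twists _ (br_twists _ (wX_twists e i)
    (wX_twists e j)) (wX_twists e k)) (wX_twists e j))).
  by apply: pi_rel; apply: rel_cubic.
- apply: (phi_br_eq0 (br_twists _ (br_twists _ (br_twists _ (wX_twists e i)
    (wX_twists e j)) (wX_twists e j)) (wX_twists e j))).
  by apply: pi_rel; apply: rel_B.
- exact: phi_D2.
- pose Yt := br_twists (nu_ K D j) (wX_twists e i) (wX_twists e j).
  apply: (phi_br_eq0 (br_twists _ (br_twists _ (br_twists _ Yt (wX_twists e k)) Yt)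
    (wX_twists e j))).
  by apply: pi_rel; apply: rel_C3.
- pose Yt := br_twists (nu_ K D k) (br_twists (nu_ K D j) (br_twists (nu_ K D i)
    (wX_twists e l) (wX_twists e i)) (wX_twists e j)) (wX_twists e k).
  apply: (phi_br_eq0 (br_twists _ (br_twists _ (br_twists _ Yt (wX_twists e j))
    (wX_twists e i)) (wX_twists e j))).
  by apply: pi_rel; apply: rel_C4.
Qed.
End TwistedRelations.

(** * The isomorphism *)

Section TwistMorphism.
Variables (K : fieldType) (charK : [pchar K] =i pred0).
Local Notation R := (hser K).
Variables (n : nat) (D : superDatum n) (d : 'I_n -> rat).
Hypothesis d_neq0 : forall i, d i != 0.
Variables (h : lmodType R).

Lemma fT_linear (P : 'M[R]_n) (rz : realization n h) : linear (fT D d P rz).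
Proof.
have [lq q1 qM _] := qproj_morph (fomp_rel (D := D) d P rz).
exact: (T_linear lq (@qproj_rel _ _ _ _)).
Qed.

Lemma fF_weight (P : 'M[R]_n) (rz : realization n h) i :
  has_weight (rAlpha rz) (fT D d P rz) false (fun l => nat_of_bool (l == i))
    (fF D d P rz i).
Proof.
have [lq q1 qM _] := qproj_morph (fomp_rel (D := D) d P rz).
exact: (X_weight lq qM (@qproj_rel _ _ _ _) false i).
Qed.

Lemma hexp_fTN (P : 'M[R]_n) (rz : realization n h) T :
  hexp (fT D d P rz T) * hexp (fT D d P rz (- T)) = 1.
Proof. by rewrite (linear_opp (@fT_linear P rz)) hexpNr. Qed.

Definition sends_generators (Z : 'I_n -> h) (P P' : 'M[R]_n)
    (rz rz' : realization n h) (f : fomp D d P' rz' -> fomp D d P rz) : Prop :=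
  [/\ forall T, f (fT D d P' rz' T) = fT D d P rz T,
      forall i, f (fE D d P' rz' i) = hexp (fT D d P rz (Z i)) * fE D d P rz i &
      forall i, f (fF D d P' rz' i) = hexp (fT D d P rz (Z i)) * fF D d P rz i].

Lemma twist_morphism Z P P' rz rz' : toral_pair Z P P' rz rz' ->
  exists2 f, is_salg_morph f & @sends_generators Z P P' rz rz' f.
Proof.
move=> PZ; set A := fomp D d P rz.
pose v (x : fgen n h) : A := match x with
  | inl T => fT D d P rz T
  | inr (inl i) => hexp (fT D d P rz (Z i)) * fE D d P rz i
  | inr (inr i) => hexp (fT D d P rz (Z i)) * fF D d P rz i
  end.
have homog x : spart (fpar D x) (pgen (fomp_rel (D := D) d P rz) x)
    = pgen (fomp_rel (D := D) d P rz) x := pgen_homog _ x.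
have even_exp T : spart false (hexp (fT D d P rz T)) = hexp (fT D d P rz T).
  by apply: even_hexp; apply: (homog (gT n T)).
have mul_homog s (x y : A) : spart false x = x -> spart s y = y ->
    spart s (x * y) = x * y.
  by move=> ex ey; have := spart_mul false s x y; rewrite ex ey.
have v_homog x : spart (fpar D x) (v x) = v x.
  case: x => [T|[i|i]]; first exact: (homog (gT n T)).
    by apply: mul_homog; [apply: even_exp|apply: (homog (gE h i))].
  by apply: mul_homog; [apply: even_exp|apply: (homog (gF h i))].
have [lq q1 qM _] := qproj_morph (fomp_rel (D := D) d P rz).
have v_rel r : fomp_rel d P' rz' r -> free_eval (p := fpar D (h := h)) v r = 0.
  apply: (twisted_relations charK d_neq0 PZ lq q1 qM (@qproj_rel _ _ _ _)).
  - exact: free_eval_linear.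
  - exact: free_eval1.
  - exact: free_evalM.
  - by move=> T; rewrite free_eval_cvar.
  - by case=> i; rewrite free_eval_cvar.
have [f fmorph fgenE] := presented_lift v_homog v_rel.
exists f => //; split=> [T|i|i]; first exact: (fgenE (gT n T)).
  exact: (fgenE (gE h i)).
exact: (fgenE (gF h i)).
Qed.

(** On [E_i] and [F_i] the exponentials of [Z i] and [- Z i] cancel. *)
Lemma twist_morphismK Z P P' rz rz' f g :
    is_salg_morph f -> @sends_generators Z P P' rz rz' f ->
    is_salg_morph g -> @sends_generators (fun i => - Z i) P' P rz' rz g ->
  cancel g f.
Proof.
move=> fm [fT_ fE_ fF_] gm [gT_ gE_ gF_].
case: (fm) => lf f1 fM fs.
apply: (presented_ext (comp_salg_morph fm gm) (id_salg_morph _)).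
case=> [T|[i|i]].
- exact: etrans (congr1 f (gT_ T)) (fT_ T).
- apply: etrans (congr1 f (gE_ i)) _.
  rewrite fM (morph_hexp lf f1 fM) fT_ fE_ mulrA -[Z i in X in _ * X * _]opprK.
  by rewrite hexp_fTN mul1r.
- apply: etrans (congr1 f (gF_ i)) _.
  rewrite fM (morph_hexp lf f1 fM) fT_ fF_ mulrA -[Z i in X in _ * X * _]opprK.
  by rewrite hexp_fTN mul1r.
Qed.

Lemma twist_isomorphism Z P P' rz rz' : toral_pair Z P P' rz rz' ->
  exists2 f, is_tsalg_iso f & @sends_generators Z P P' rz rz' f.
Proof.
move=> PZ; have [f fm fg] := twist_morphism PZ.
have [g gm gg] := twist_morphism (toral_pair_sym PZ).
exists f => //; have gK := twist_morphismK fm fg gm gg.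
have fK : cancel f g.
  apply: (twist_morphismK gm gg fm).
  by rewrite (_ : (fun i => - - Z i) = Z) //; apply/funext => i; rewrite opprK.
case: (fm) (gm) => lf _ _ _ [lg _ _ _].
split=> //; first by exists g.
move=> N x; split; last exact: hdiv_linear.
by move=> /(hdiv_linear lg); rewrite fK.
Qed.
End TwistMorphism.

Section ToralTwist.
Variables (K : fieldType) (charK : [pchar K] =i pred0).
Local Notation R := (hser K).
Variables (n : nat) (h : lmodType R) (rz : realization n h).
Variables (t : nat) (H : 'I_t -> h) (Phi : 'M[R]_t).
Hypothesis Phi_anti : Phi^T = - Phi.

Lemma Phi_antiE g k : Phi k g = - Phi g k.
Proof. by have := congr1 (fun M : 'M_t => M g k) Phi_anti; rewrite !mxE. Qed.

(** The exponent of the element [K_(Phi, i)]. *)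
Definition half_shift i : h := hcst 2^-1 *: twist_shift H Phi rz i.

Lemma hcst_half : hcst 2^-1 + hcst 2^-1 = 1 :> R.
Proof.
rewrite -hcstD -mulr2n -[X in hcst X]mulr_natr mulVf //.
by have /pcharf0P -> := charK.
Qed.

Lemma half_shiftD i : half_shift i + half_shift i = twist_shift H Phi rz i.
Proof. by rewrite -scalerDl hcst_half scale1r. Qed.

Lemma rAlpha_twist_shift i j : rAlpha rz j (twist_shift H Phi rz i)
  = - (alphaH H rz *m Phi *m (alphaH H rz)^T) i j.
Proof.
transitivity (\sum_g \sum_k rAlpha rz i (H g) * Phi k g * rAlpha rz j (H k)).
  rewrite linear_sum; apply: eq_bigr => g _.
  by rewrite linear_sum; apply: eq_bigr => k _; rewrite linearZ.
rewrite exchange_big mxE -sumrN; apply: eq_bigr => k _.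
rewrite !mxE mulr_suml -sumrN; apply: eq_bigr => g _.
by rewrite !mxE Phi_antiE mulrN mulNr.
Qed.

Lemma toral_twist_pair (P : 'M[R]_n) :
  toral_pair half_shift P (twist_matrix H Phi rz P) rz (twist_realization H Phi rz).
Proof.
set M := alphaH H rz *m Phi *m (alphaH H rz)^T.
have M_anti i j : M j i = - M i j.
  have : M^T = - M by rewrite !trmx_mul trmxK Phi_anti mulNmx mulmxN mulmxA.
  by move=> /(congr1 (fun N : 'M_n => N i j)); rewrite !mxE.
have rAlphaZ i j : rAlpha rz j (half_shift i) = - (hcst 2^-1 * M i j).
  by rewrite linearZ /= rAlpha_twist_shift mulrN.
split=> [i|i|//|i j|i j].
- by rewrite half_shiftD.
- by rewrite half_shiftD.
- have twE k l : twist_matrix H Phi rz P k l = P k l - M k l.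
    by rewrite /twist_matrix mxE [X in _ + X]mxE.
  rewrite rAlphaZ !twE (M_anti i j).
  move: (hcst _) (M i j) (P i j) (P j i) => c m p q; ring.
- by rewrite !rAlphaZ M_anti mulrN.
Qed.
End ToralTwist.

Theorem proposition4p2p8 (K : fieldType) (charK : [pchar K] =i pred0)
  (n : nat) (D : superDatum n) (d : 'I_n -> rat)
  (hd : minimal_symmetrizer D d)
  (h : lmodType (hser K)) (rz : realization n h)
  (hrz : is_realization (cartan_matrix_P K D d) rz) (rz_straight : straight rz)
  (t : nat) (H : 'I_t -> h) (hH : is_basis H)
  (Phi : 'M[hser K]_t) (hPhi : Phi^T = - Phi) :
  let PA := cartan_matrix_P K D d in
  let PPhi := twist_matrix H Phi rz PA in
  let rzPhi := twist_realization H Phi rz in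
  let UPhi : topSuperAlg K := fomp D d PPhi rzPhi in
  let UF : topHopf K :=
    twist_deformation (H := fomp_hopf D d PA rz) (toral_twist D d PA rz H Phi) in
  let L : 'I_n -> UF := twistL D d PA rz H Phi in
  let Kk : 'I_n -> UF := twistK D d PA rz H Phi in
  exists f : UPhi -> UF,
    [/\ is_tsalg_iso f,
        forall i, f (fE D d PPhi rzPhi i) = rinv (L i) * (fE D d PA rz i : UF),
        forall T, f (fT D d PPhi rzPhi T) = (fT D d PA rz T : UF),
        forall i, f (fF D d PPhi rzPhi i) = (fF D d PA rz i : UF) * Kk i &
        forall i, Kk i = rinv (L i)].
Proof.
move=> PA PPhi rzPhi UPhi UF L Kk.
have d_neq0 i : d i != 0 by case: hd => -[/(_ i) []].
have PZ := toral_twist_pair charK rz H hPhi PA.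
have [f f_iso [f_T f_E f_F]] := twist_isomorphism charK D d_neq0 PZ.
pose Z := half_shift rz H Phi.
have KE i : twistK D d PA rz H Phi i = hexp (fT D d PA rz (Z i)).
  congr hexp; have lT := fT_linear D d PA rz.
  rewrite (linear_scale lT) (linear_bigsum lT); congr (_ *: _).
  apply: eq_bigr => g _; rewrite (linear_bigsum lT); apply: eq_bigr => k _.
  by rewrite (linear_scale lT).
have LE i : twistL D d PA rz H Phi i = hexp (fT D d PA rz (- Z i)).
  congr hexp; have lT := fT_linear D d PA rz.
  rewrite (linear_opp lT) (linear_scale lT) (linear_bigsum lT) -scalerN -sumrN.
  congr (_ *: _); apply: eq_bigr => g _; rewrite (linear_bigsum lT) -sumrN.
  apply: eq_bigr => k _.
  by rewrite (linear_scale lT) (Phi_antiE hPhi g k) mulrN scaleNr opprK.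
have rinvL i : rinv (twistL D d PA rz H Phi i) = hexp (fT D d PA rz (Z i)).
  rewrite LE; apply: rinvE; last exact: hexp_fTN.
  by rewrite -{2}[Z i]opprK; apply: hexp_fTN.
have FK i : hexp (fT D d PA rz (Z i)) * fF D d PA rz i
    = fF D d PA rz i * twistK D d PA rz H Phi i.
  have Z0 : weight (rAlpha rz) false (fun l => nat_of_bool (l == i)) (Z i) = 0.
    by rewrite weight_delta (alpha_Z_diag charK (pair_anti PZ)) mulr0.
  have := has_weight_expT charK (Z i) (fF_weight D d PA rz i).
  rewrite Z0 oppr0 scalar_exp0 scale1r => FK.
  by rewrite (KE i); exact: esym FK.
exists f; split; [exact: f_iso | move=> i | exact: f_T | move=> i | move=> i].
- by apply: etrans (f_E i) _; rewrite -(rinvL i).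
- by apply: etrans (f_F i) _; rewrite (FK i).
- exact: etrans (KE i) (esym (rinvL i)).
Qed.
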